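(* Let $\sigma=(f,g)$ be a normal sequence of homogeneous polynomials in $R=\kappa[x_0,\ldots,x_3]$ with $\deg f=d_f+1$, $\deg g=d_g+1$. For a saturated syzygy $\nu\in H^0(\mathcal{T}_\sigma(l))$ of degree $l\ge0$, let $B_\nu\subset\mathbb{P}^3$ be the associated curve. Then $$\deg(B_\nu)=l^2-l(d_f+d_g)+m_0-m(\sigma),\qquad\text{where } m_0=d_f^2+d_g^2+d_fd_g.$$
   Context: Let $\kappa$ be an algebraically closed field of characteristic zero, $R=\kappa[x_0,\ldots,x_3]$ and $\mathbb{P}^3=\operatorname{Proj}R$. A sequence $\sigma=(f,g)$ is an algebraically independent pair of homogeneous polynomials in $R$ with $\deg f=d_f+1$, $\deg g=d_g+1$; set $d=d_f+d_g$. Its Jacobian matrix (rows the gradients of $f$ and $g$) defines $\nabla\sigma:\mathcal{O}_{\mathbb{P}^3}^{\oplus4}\to\mathcal{O}_{\mathbb{P}^3}(d_f)\oplus\mathcal{O}_{\mathbb{P}^3}(d_g)$. Write $\mathcal{T}_\sigma=\ker(\nabla\sigma)$ (reflexive of rank 2) and $\mathcal{Q}_\sigma=\operatorname{coker}(\nabla\sigma)$. The sequence is normal if $\operatorname{Supp}\mathcal{Q}_\sigma$ has codimension at least 2. For normal $\sigma$, $\chi(\mathcal{Q}_\sigma(t))=m(\sigma)\,t+\text{const}$ defines the integer $m(\sigma)\ge0$. A syzygy of degree $l$ is a section $\nu\in H^0(\mathcal{T}_\sigma(l))$; it is saturated if it is nonzero and the cokernel of $\nu:\mathcal{O}_{\mathbb{P}^3}(-l)\to\mathcal{T}_\sigma$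 is torsion-free, in which case there is an exact sequence $0\to\mathcal{O}_{\mathbb{P}^3}(-l)\xrightarrow{\nu}\mathcal{T}_\sigma\to\mathcal{I}_{B_\nu}(l-d)\to0$, where $B_\nu$ is the associated curve (empty or a locally Cohen–Macaulay closed subscheme of pure dimension 1; the degree of the empty scheme is 0). *)

(* Defs.v *)
From HB Require Import structures.
From mathcomp Require Import all_boot all_order all_algebra.
From mathcomp Require Export mpoly fraction.

Set Implicit Arguments.
Unset Strict Implicit.
Unset Printing Implicit Defensive.

Import GRing.Theory.
Local Open Scope ring_scope.

(* Conventions.  R = k[x_0,...,x_3] and K = Frac R.  A graded R-submodule A of
   R(a_0) + ... + R(a_(n-1)) is given as a predicate on column vectors, together
   with the twists a : 'I_n -> int, and stands for the associated subsheaf of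
   O(a_0) + ... + O(a_(n-1)) on P^3.  Two such submodules B <= A (with the same
   twists) stand for the coherent sheaf A/B.  All sheaves are handled through
   their sections on the open sets D(x_S) := { x_i <> 0 for all i in S }, S
   nonempty, which are computed inside K^n. *)

Section ProjectiveThreeSpace.

Variable k : fieldType.

Local Notation R := {mpoly k[4]}.
Local Notation K := {fraction {mpoly k[4]}}.

(* Homogeneous of degree z : int; R_z = 0 for z < 0. *)
Definition homogz (z : int) (p : R) : Prop :=
  if z is Posz d then p \is d.-homog else p = 0.

Definition graded_piece n (a : 'I_n -> int) (z : int) (w : 'cV[R]_n) : Prop :=
  forall j, homogz (z + a j) (w j ord0).

Definition x_prod (S : {set 'I_4}) : R := \prod_(i in S) 'X_i.

(* sections a A t S v : v = w / x_S^N with w in A is a section over D(x_S) of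
   the t-th twist of the sheaf associated with A. *)
Definition sections n (a : 'I_n -> int) (A : 'cV[R]_n -> Prop) (t : int)
    (S : {set 'I_4}) (v : 'cV[K]_n) : Prop :=
  exists (N : nat) (w : 'cV[R]_n),
    [/\ A w, graded_piece a ((N * #|S|)%N%:Z + t) w
      & map_mx (@FracField.tofrac R) w = FracField.tofrac (x_prod S ^+ N) *: v].

(* The ring O(D(x_S)), i.e. the degree 0 part of R[1/x_S]. *)
Definition regular_on (S : {set 'I_4}) (r : K) : Prop :=
  exists (N : nat) (p : R),
    p \is (N * #|S|)%N.-homog
    /\ FracField.tofrac p = FracField.tofrac (x_prod S ^+ N) * r.

Definition same_subsheaf n (a : 'I_n -> int) (A A' : 'cV[R]_n -> Prop) : Prop :=
  forall (i : 'I_4) (v : 'cV[K]_n),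
    sections a A 0 [set i] v <-> sections a A' 0 [set i] v.

Definition torsion_free n (a : 'I_n -> int) (A B : 'cV[R]_n -> Prop) : Prop :=
  forall (i : 'I_4) (v : 'cV[K]_n) (r : K),
    sections a A 0 [set i] v -> regular_on [set i] r -> r <> 0 ->
    sections a B 0 [set i] (r *: v) -> sections a B 0 [set i] v.

(* Cech cohomology of A/B for the standard cover of P^3.  A p-cochain is a
   family indexed by the (p+1)-element subsets S of 'I_4, extended by 0 to all
   subsets. *)
Definition cochain n (a : 'I_n -> int) (A : 'cV[R]_n -> Prop) (t : int)
    (p : nat) (c : {ffun {set 'I_4} -> 'cV[K]_n}) : Prop :=
  forall S : {set 'I_4},
    if #|S| == p.+1 then sections a A t S (c S) else c S = 0.

Definition cech_d n (c : {ffun {set 'I_4} -> 'cV[K]_n}) :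
    {ffun {set 'I_4} -> 'cV[K]_n} :=
  [ffun S : {set 'I_4} =>
     \sum_(i in S) (-1) ^+ #|[set j in S | (j < i)%N]| *: c (S :\ i)].

Definition cocycle n (a : 'I_n -> int) (A B : 'cV[R]_n -> Prop) (t : int)
    (p : nat) (c : {ffun {set 'I_4} -> 'cV[K]_n}) : Prop :=
  cochain a A t p c /\ cochain a B t p.+1 (cech_d c).

Definition coboundary n (a : 'I_n -> int) (A B : 'cV[R]_n -> Prop) (t : int)
    (p : nat) (c : {ffun {set 'I_4} -> 'cV[K]_n}) : Prop :=
  if p is q.+1
  then exists b, cochain a A t q b /\ cochain a B t p (c - cech_d b)
  else cochain a B t p c.

(* U/V has dimension m over k, for k-subspaces V <= U of a K-vector space. *)
Definition quotient_dim (E : lmodType K) (U V : E -> Prop) (m : nat) : Prop :=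
  exists e : 'I_m -> E,
    (forall i, U (e i)) /\
    (forall u, U u -> exists! c : {ffun 'I_m -> k},
       V (u - \sum_i FracField.tofrac ((c i)%:MP : R) *: e i)).

(* chi((A/B)(t)) = z, including the finiteness of the cohomology groups. *)
Definition euler_char n (a : 'I_n -> int) (A B : 'cV[R]_n -> Prop) (t z : int) :
    Prop :=
  exists h : nat -> nat,
    (forall p, (p < 4)%N ->
       quotient_dim (cocycle a A B t p) (coboundary a A B t p) (h p))
    /\ z = \sum_(p < 4) (-1) ^+ p * (h p)%:Z.

Record homogeneous_ideal (I : R -> Prop) : Prop := HomogeneousIdeal {
  hideal0 : I 0;
  hidealD : forall p q, I p -> I q -> I (p + q);
  hidealM : forall r p, I p -> I (r * p);
  hideal_homog : forall d p, I p -> I (pihomog mdeg d p) }.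

(* The points of the scheme P^3. *)
Record proj_point (P : R -> Prop) : Prop := ProjPoint {
  point_ideal : homogeneous_ideal P;
  point_prime : forall p q, P (p * q) -> P p \/ P q;
  point_relevant : exists i : 'I_4, ~ P 'X_i }.

Definition ideal_proper (P Q : R -> Prop) : Prop :=
  (forall p, P p -> Q p) /\ (exists p, Q p /\ ~ P p).

(* The stalk of A/B at P is nonzero. *)
Definition in_support n (a : 'I_n -> int) (A B : 'cV[R]_n -> Prop)
    (P : R -> Prop) : Prop :=
  exists (z : int) (w : 'cV[R]_n),
    [/\ A w, graded_piece a z w
      & forall (d : nat) (s : R), s \is d.-homog -> ~ P s -> ~ B (s *: w)].

(* Every point of the support has height at least 2 (true if it is empty). *)
Definition support_codim_ge2 n (a : 'I_n -> int) (A B : 'cV[R]_n -> Prop) :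
    Prop :=
  forall P, proj_point P -> in_support a A B P ->
    exists P0 P1, [/\ proj_point P0, proj_point P1,
                      ideal_proper P0 P1 & ideal_proper P1 P].

(* Closed subschemes of P^3 correspond bijectively to homogeneous ideals that
   are saturated with respect to the irrelevant ideal. *)
Record closed_subscheme (I : R -> Prop) : Prop := ClosedSubscheme {
  subscheme_ideal : homogeneous_ideal I;
  subscheme_sat : forall p,
    (forall i : 'I_4, exists N : nat, I ('X_i ^+ N * p)) -> I p }.

Definition ideal_col (I : R -> Prop) (w : 'cV[R]_1) : Prop := I (w ord0 ord0).

(* deg B = e for B of dimension at most 1 with ideal I: the Hilbert polynomial
   is chi(O_B(t)) = e t + const.  The empty scheme has degree 0. *)
Definition curve_degree (I : R -> Prop) (e : int) : Prop :=
  exists c : int, forall t : int,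
    euler_char (fun _ : 'I_1 => 0) (fun _ => True) (ideal_col I) t (e * t + c).

Section Sequence.

Variables f g : R.

Definition alg_independent : Prop :=
  forall P : {mpoly k[2]}, comp_mpoly [tuple f; g] P = 0 -> P = 0.

Definition is_sequence (df dg : nat) : Prop :=
  [/\ f \is df.+1.-homog, g \is dg.+1.-homog & alg_independent].

Definition jacobian : 'M[R]_(2, 4) :=
  \matrix_(i, j) (tnth [tuple f; g] i)^`M(j).

Definition jac_twist (df dg : nat) (i : 'I_2) : int :=
  (tnth [tuple df; dg] i)%:Z.

(* T_sigma, as a subsheaf of O^4. *)
Definition tangent_sheaf (v : 'cV[R]_4) : Prop := jacobian *m v = 0.

(* The image of nabla sigma in O(df) + O(dg); Q_sigma is the quotient. *)
Definition jacobian_image (w : 'cV[R]_2) : Prop := exists v, w = jacobian *m v.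

Definition normal_sequence (df dg : nat) : Prop :=
  is_sequence df dg
  /\ support_codim_ge2 (jac_twist df dg) (fun _ => True) jacobian_image.

(* m = m(sigma): chi(Q_sigma(t)) = m t + const. *)
Definition is_m (df dg : nat) (m : int) : Prop :=
  exists c : int, forall t : int,
    euler_char (jac_twist df dg) (fun _ => True) jacobian_image t (m * t + c).

(* H^0(T_sigma(l)), as the kernel of nabla sigma on H^0(O(l)^4) = R_l^4. *)
Definition syzygy (l : nat) (nu : 'cV[R]_4) : Prop :=
  (forall j, nu j ord0 \is l.-homog) /\ tangent_sheaf nu.

(* The image of nu : O(-l) -> T_sigma. *)
Definition line (nu v : 'cV[R]_4) : Prop := exists r : R, v = r *: nu.

Definition saturated_syzygy (l : nat) (nu : 'cV[R]_4) : Prop :=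
  [/\ syzygy l nu, nu <> 0
    & torsion_free (fun _ => 0) tangent_sheaf (line nu)].

(* I is the saturated ideal of a closed subscheme B such that there is an exact
   sequence of sheaves 0 -> O(-l) -> T_sigma -> I_B(l-d) -> 0 whose first map
   is nu.  Since tangent_sheaf and I are the full modules of twisted sections,
   a morphism T_sigma -> I_B(l-d) is the same as a homomorphism of graded
   modules phi : T -> I(l-d). *)
Definition associated_curve (df dg l : nat) (nu : 'cV[R]_4) (I : R -> Prop) :
    Prop :=
  closed_subscheme I /\
  exists phi : 'cV[R]_4 -> R,
    [/\ forall (r : R) u v, tangent_sheaf u -> tangent_sheaf v ->
          phi (r *: u + v) = r * phi u + phi v,
        forall v, tangent_sheaf v -> I (phi v),
        forall (t : int) v, tangent_sheaf v -> graded_piece (fun _ => 0) t v ->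
          homogz (t + (l%:Z - (df + dg)%N%:Z)) (phi v),
        same_subsheaf (fun _ => 0)
          (fun v => tangent_sheaf v /\ phi v = 0) (line nu)
      & same_subsheaf (fun _ => l%:Z - (df + dg)%N%:Z)
          (fun w => exists v, tangent_sheaf v /\ w = (phi v)%:M)
          (ideal_col I)].

End Sequence.

End ProjectiveThreeSpace.

(* Main.v *)
Require Import Defs.
From HB Require Import structures.
From mathcomp Require Import all_boot all_order all_algebra.
From mathcomp Require Import zify ring.
From Stdlib Require Import Classical.
Import GRing.Theory.
Local Open Scope ring_scope.

Set Implicit Arguments.
Unset Strict Implicit.
Unset Printing Implicit Defensive.

(** Let H(t) be the Euler characteristic of O(t), which is
    (t + 1)(t + 2)(t + 3) / 6.  Write T for the kernel of the Jacobian map, W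
    for its image and Q for its cokernel, put s = l - d_f - d_g and let
    m t + c be the Euler characteristic of Q(t).  The exact sequences
      0 -> W -> O(d_f) + O(d_g) -> Q -> 0,    0 -> T -> O^4 -> W -> 0,
      0 -> O(-l) -> T -> I_B(s) -> 0,         0 -> I_B -> O -> O_B -> 0
    express the Euler characteristic of O_B(t + s) as
      H(t + s) - 4 H(t) + H(t + d_f) + H(t + d_g) - (m t + c) + H(t - l).
    The five shifts s, 0, d_f, d_g, -l, taken with the weights 1, -4, 1, 1, 1,
    have total weight 0 and weighted sum 0, so the terms in t^3 and t^2
    cancel; the coefficient of t is half of the weighted sum of the squares
    of the shifts, minus m, which is the asserted degree.

    Cohomology is that of the Cech complexes, whose terms are quotients of
    k-subspaces of a vector space over K.  Additivity of Euler characteristics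
    is proved for three nested subcomplexes of one complex.  The long exact
    sequence cuts each of the three cohomology spaces into two pieces, shared
    by consecutive terms, so finiteness passes from any two of the Euler
    characteristics to the third: this gives [chi_sub], [chi_quot] and
    [chi_add].  A homomorphism of graded modules identifies the quotient by
    its kernel with its image ([euler_morphism]); it is only defined on a
    submodule of R^n, and is spread to sections as a linear relation, for
    which isomorphism invariance holds as well ([chi_iso]).  Subsheaves that
    agree on the four sets D(x_i) in degree 0 have the same sections over all
    intersections and in all twists ([same_subsheaf_sections]).

    The value of H comes from the classical computation of the cohomology of
    O(t): after clearing denominators a cochain is a family of polynomials,
    and for a fixed monomial without pole along x_i, adding the vertex i is a
    contracting homotopy ([poly_homotopy]).  What remains is the polynomials
    of degree t in degree 0, and in degree 3 the monomials with negative
    exponents only ([euler_structure]). *)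

(** * Dimensions of subquotients *)

Section RelativeDimension.

Variables (F : fieldType) (L : nzRingType) (emb : {rmorphism F -> L}).

(** Dimensions are taken over F, while the ambient space is a module over L:
    F will be the ground field k and L the field K of rational functions. *)
Definition qdim (E : lmodType L) (U V : E -> Prop) (m : nat) : Prop :=
  exists e : 'I_m -> E,
    (forall i, U (e i)) /\
    (forall u, U u -> exists! c : {ffun 'I_m -> F},
       V (u - \sum_i emb (c i) *: e i)).

Definition subspace (E : lmodType L) (P : E -> Prop) : Prop :=
  P 0 /\ forall (c : F) u v, P u -> P v -> P (emb c *: u + v).

(** Spanning and independence modulo V, indexed by any finite type: in this
    form bases can be concatenated and enumerated by monomials. *)
Definition qbasis (E : lmodType L) (J : finType) (e : J -> E)
    (U V : E -> Prop) : Prop :=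
  [/\ forall j, U (e j),
      forall u, U u -> exists c : J -> F, V (u - \sum_j emb (c j) *: e j)
    & forall c : J -> F, V (\sum_j emb (c j) *: e j) -> forall j, c j = 0].

Section Subspaces.

Variable E : lmodType L.
Implicit Types (P U V W : E -> Prop).

Lemma subspaceD P u v : subspace P -> P u -> P v -> P (u + v).
Proof. by case=> _ h Pu Pv; rewrite -[u]scale1r -(rmorph1 emb); apply: h. Qed.

Lemma subspaceZ P c u : subspace P -> P u -> P (emb c *: u).
Proof. by case=> P0 h Pu; rewrite -[_ *: _]addr0; apply: h. Qed.

Lemma subspaceN P u : subspace P -> P u -> P (- u).
Proof.
by move=> sP Pu; rewrite -scaleN1r -(rmorph1 emb) -rmorphN; apply: subspaceZ.
Qed.

Lemma subspaceB P u v : subspace P -> P u -> P v -> P (u - v).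
Proof. by move=> sP Pu Pv; apply: subspaceD => //; apply: subspaceN. Qed.

Lemma subspace_sum P (J : finType) (c : J -> F) (e : J -> E) :
  subspace P -> (forall j, P (e j)) -> P (\sum_j emb (c j) *: e j).
Proof.
move=> sP Pe; elim/big_ind: _ => [|x y|j _]; first by case: sP.
  exact: subspaceD.
exact: subspaceZ.
Qed.

Lemma subspaceBl P u v : subspace P -> P (u - v) -> P v -> P u.
Proof. by move=> sP Puv Pv; rewrite -[u](subrK v); apply: subspaceD. Qed.

Definition sum_space U V (x : E) : Prop := exists u v, [/\ U u, V v & x = u + v].
Definition cap_space U V (x : E) : Prop := U x /\ V x.

Lemma sum_space_subspace U V : subspace U -> subspace V -> subspace (sum_space U V).
Proof.
move=> sU sV; split; first by exists 0, 0; rewrite addr0; case: sU; case: sV.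
move=> c _ _ [u1 [v1 [Uu1 Vv1 ->]]] [u2 [v2 [Uu2 Vv2 ->]]].
exists (emb c *: u1 + u2), (emb c *: v1 + v2); split.
- by case: sU => _; apply.
- by case: sV => _; apply.
- by rewrite scalerDr addrACA.
Qed.

Lemma cap_space_subspace U V : subspace U -> subspace V -> subspace (cap_space U V).
Proof.
move=> [U0 sU] [V0 sV]; split=> // c u v [Uu Vu] [Uv Vv].
by split; [apply: sU | apply: sV].
Qed.

Lemma sum_space_l U V x : subspace V -> U x -> sum_space U V x.
Proof. by case=> V0 _ Ux; exists x, 0; rewrite addr0. Qed.

Lemma sum_space_r U V x : subspace U -> V x -> sum_space U V x.
Proof. by case=> U0 _ Vx; exists 0, x; rewrite add0r. Qed.

Lemma qbasis_qdim (J : finType) (e : J -> E) U V :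
  subspace V -> qbasis e U V -> qdim U V #|J|.
Proof.
move=> sV [Ue span indep].
have reidx (c : J -> F) :
  \sum_(i < #|J|) emb (c (enum_val i)) *: e (enum_val i) =
  \sum_j emb (c j) *: e j.
  by rewrite [RHS](reindex _ (onW_bij _ (@enum_val_bij J))).
exists (fun i => e (enum_val i)); split=> // u /span[c Vc].
exists [ffun i => c (enum_val i)]; split.
  by under eq_bigr do rewrite ffunE; rewrite reidx.
move=> c' Vc'; apply/ffunP=> i; rewrite ffunE.
pose d j := c j - c' (enum_rank j).
suff: d (enum_val i) = 0 by rewrite /d enum_valK => /subr0_eq.
apply: indep; rewrite -reidx.
have -> : \sum_(i < #|J|) emb (d (enum_val i)) *: e (enum_val i) =
  (u - \sum_(i < #|J|) emb (c' i) *: e (enum_val i)) - (u - \sum_j emb (c j) *: e j).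
  rewrite -reidx opprB addrC addrA subrK -sumrB /=.
  apply: eq_bigr => x _.
  by rewrite /d enum_valK rmorphB scalerBl.
exact: subspaceB.
Qed.

Lemma qdim_qbasis U V m : subspace U -> subspace V -> qdim U V m ->
  exists e : 'I_m -> E, qbasis e U V.
Proof.
move=> sU sV [e [Ue h]]; exists e; split=> //.
  by move=> u /h[c [Vc _]]; exists c.
move=> c Vc j; have /h[c0 [_ c0_uniq]] : U 0 by case: sU.
have /ffunP/(_ j) : [ffun j => - c j] = [ffun _ => 0] :> {ffun 'I_m -> F}.
  rewrite -[LHS]c0_uniq; first apply: c0_uniq.
    rewrite big1 ?subr0; first by case: sV.
    by move=> i _; rewrite ffunE rmorph0 scale0r.
  rewrite sub0r -sumrN; under eq_bigr do rewrite ffunE rmorphN scaleNr opprK.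
  by [].
by rewrite !ffunE => /eqP; rewrite oppr_eq0 => /eqP.
Qed.

(** The matrix of coordinates of one basis in the other has a nonzero left
    kernel as soon as it has more rows than columns. *)
Lemma qdim_le U V m m' : subspace U -> subspace V ->
  qdim U V m -> qdim U V m' -> (m <= m')%N.
Proof.
move=> sU sV /(qdim_qbasis sU sV)[e [Ue _ indep]].
move=> /(qdim_qbasis sU sV)[e' [_ span _]].
have /fin_all_exists[M hM] : forall i, exists c : 'I_m' -> F,
  V (e i - \sum_j emb (c j) *: e' j) by move=> i; apply: span.
pose A := \matrix_(i, j) M i j.
rewrite leqNgt; apply/negP => lt_m'm.
have /rowV0Pn[v /sub_kermxP vA0 /rV0Pn[j vj]] : kermx A != 0.
  rewrite -mxrank_eq0 mxrank_ker subn_eq0 -ltnNge.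
  exact: leq_ltn_trans (rank_leq_col A) lt_m'm.
case/eqP: vj; apply: (indep (fun i => v 0 i)).
have -> : \sum_j emb (v 0 j) *: e j =
   \sum_j emb (v 0 j) *: (e j - \sum_i emb (M j i) *: e' i).
  under [RHS]eq_bigr do rewrite scalerBr.
  rewrite sumrB [X in _ - X](_ : _ = 0) ?subr0 //.
  under eq_bigr do rewrite scaler_sumr.
  rewrite exchange_big big1 //= => x _.
  under eq_bigr do rewrite scalerA -rmorphM.
  rewrite -scaler_suml -rmorph_sum /=.
  move/rowP/(_ x): vA0; rewrite !mxE => vA0.
  suff -> : \sum_i v 0 i * M i x = 0 by rewrite rmorph0 scale0r.
  by rewrite -[RHS]vA0; apply: eq_bigr => i _; rewrite mxE.
exact: subspace_sum.
Qed.

Lemma qdim_uniq U V m m' : subspace U -> subspace V ->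
  qdim U V m -> qdim U V m' -> m = m'.
Proof.
move=> sU sV h h'; apply/eqP; rewrite eqn_leq.
by rewrite (qdim_le sU sV h h') (qdim_le sU sV h' h).
Qed.

(** A matrix of maximal rank with rows in P does it: a vector of P outside its
    row space would give a matrix of larger rank. *)
Lemma subspace_rowspace m (P : 'rV[F]_m -> Prop) :
  P 0 -> (forall c u v, P u -> P v -> P (c *: u + v)) ->
  exists A : 'M_m, forall v, P v <-> (v <= A)%MS.
Proof.
move=> P0 Pl.
suff h d (A : 'M[F]_m) : (forall v, (v <= A)%MS -> P v) ->
    (m - \rank A <= d)%N -> exists A : 'M_m, forall v, P v <-> (v <= A)%MS.
  by apply: (h m 0); rewrite ?leq_subr // => v; rewrite submx0 => /eqP ->.
elim: d A => [|d IHd] A PA hd.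
  exists A => v; split=> [_|]; last exact: PA.
  by apply: submx_full; rewrite /row_full eqn_leq rank_leq_col -subn_eq0 -leqn0.
have [hA|/not_all_ex_not[v /(imply_to_and (P v) _)[Pv vA]]] :=
    classic (forall v, P v -> (v <= A)%MS).
  by exists A => v; split; [apply: hA | apply: PA].
apply: (IHd (A + v)%MS).
  move=> w /sub_addsmxP[[a b] /= ->].
  have [c ->] : exists c, b *m v = c *: v.
    by exists (b 0 0); rewrite [b]mx11_scalar mul_scalar_mx mxE eqxx.
  by rewrite addrC; apply: Pl => //; apply: PA; apply: submxMl.
have ltA : (A < A + v)%MS.
  rewrite ltmxE addsmxSl; apply/negP => /(submx_trans (addsmxSr A v)).
  exact: vA.
rewrite -ltnS (leq_trans _ hd) // ltn_sub2l ?rank_ltmx //.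
exact: leq_trans (rank_ltmx ltA) (rank_leq_col _).
Qed.

Lemma qbasis_cat U W V (J1 J2 : finType) (e1 : J1 -> E) (e2 : J2 -> E) :
  subspace V -> (forall x, V x -> W x) -> subspace W -> (forall x, W x -> U x) ->
  qbasis e1 U W -> qbasis e2 W V ->
  qbasis (fun j : J1 + J2 => match j with inl i => e1 i | inr i => e2 i end) U V.
Proof.
move=> sV VW sW WU [U1 s1 i1] [W2 s2 i2].
split=> [[i|i]|u /s1[c1 /s2[c2 V12]]|c]; [exact: U1|exact/WU/W2| |].
  exists (fun j => match j with inl i => c1 i | inr i => c2 i end).
  by rewrite big_sumType /= opprD addrA.
rewrite big_sumType /= => Vc.
have c1_0 : forall i, c (inl i) = 0.
  apply: (i1 (fun i => c (inl i))).
  rewrite -[X in W X](addrK (\sum_i emb (c (inr i)) *: e2 i)).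
  by apply: subspaceB; [|apply: VW|apply: subspace_sum].
case=> i //; apply: (i2 (fun i => c (inr i))).
by move: Vc; rewrite big1 ?add0r // => j _; rewrite c1_0 rmorph0 scale0r.
Qed.

Lemma qdim_add U W V m1 m2 :
  subspace U -> subspace W -> subspace V ->
  (forall x, V x -> W x) -> (forall x, W x -> U x) ->
  qdim U W m1 -> qdim W V m2 -> qdim U V (m1 + m2).
Proof.
move=> sU sW sV VW WU.
move=> /(qdim_qbasis sU sW)[e1 b1] /(qdim_qbasis sW sV)[e2 b2].
have := qbasis_qdim sV (qbasis_cat sV VW sW WU b1 b2).
by rewrite card_sum !card_ord.
Qed.

(** Coordinates turn W/V into a subspace of F^m, that is, into a row space;
    a row base of it and one of a complement give the two bases. *)
Lemma qdim_split U W V m :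
  subspace U -> subspace W -> subspace V ->
  (forall x, V x -> W x) -> (forall x, W x -> U x) ->
  qdim U V m -> exists m1 m2, [/\ qdim U W m1, qdim W V m2 & m = (m1 + m2)%N].
Proof.
move=> sU sW sV VW WU UV.
suff [m1 [m2 [h1 h2]]] : exists m1 m2, qdim U W m1 /\ qdim W V m2.
  exists m1, m2; split=> //; apply: (qdim_uniq sU sV UV).
  exact: qdim_add h1 h2.
have [e [Ue span indep]] := qdim_qbasis sU sV UV.
pose comb (v : 'rV[F]_m) := \sum_j emb (v 0 j) *: e j.
have combD c u v : comb (c *: u + v) = emb c *: comb u + comb v.
  rewrite /comb scaler_sumr -big_split /=; apply: eq_bigr => j _.
  by rewrite !mxE rmorphD rmorphM scalerDl scalerA.
have comb0 : comb 0 = 0.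
  by rewrite /comb big1 // => j _; rewrite mxE rmorph0 scale0r.
have comb_mul r (c : 'rV_r) (B : 'M_(r, m)) :
    comb (c *m B) = \sum_j emb (c 0 j) *: comb (row j B).
  rewrite mulmx_sum_row; elim/big_rec2: _ => [|j x y _ <-]; first exact: comb0.
  exact: combD.
have Ucomb v : U (comb v) by apply: subspace_sum.
have [A hA] : exists A : 'M_m, forall v, W (comb v) <-> (v <= A)%MS.
  apply: subspace_rowspace; first by rewrite comb0; case: sW.
  by move=> c u v Wu Wv; rewrite combD; case: sW => _; apply.
have span' u : U u -> exists v, V (u - comb v).
  move=> /span[c Vc]; exists (\row_j c j).
  by rewrite /comb; under eq_bigr do rewrite mxE.
have indep' v : V (comb v) -> v = 0.
  by move=> /indep h; apply/rowP => j; rewrite mxE h.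
have mulB0 r (c : 'I_r -> F) (B : 'M_(r, m)) : row_free B ->
    (\row_i c i) *m B = 0 -> forall i, c i = 0.
  move=> Bfree cB0 i; have /rowP/(_ i) : \row_i c i = 0.
    by apply: (row_free_inj Bfree); rewrite cB0 mul0mx.
  by rewrite !mxE.
pose B1 := row_base (A^C)%MS; pose B2 := row_base A.
exists (\rank (A^C)%MS), (\rank A); split.
  have -> : \rank (A^C)%MS = #|'I_(\rank (A^C)%MS)| by rewrite card_ord.
  apply: (qbasis_qdim (e := fun i => comb (row i B1))) => //; split=> //.
    move=> u /span'[v Vv].
    have /sub_addsmxP[[D1 D2] /= Dv] : (v <= A + B1)%MS.
      apply: submx_full; rewrite -sub1mx.
      rewrite (adds_eqmx (eqmx_refl A) (eq_row_base _)).
      by rewrite sub1mx addsmx_compl_full.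
    exists (fun j => D2 0 j); rewrite -comb_mul.
    have -> : u - comb (D2 *m B1) = (u - comb v) + comb (D1 *m A).
      have -> : comb v = comb (D1 *m A) + comb (D2 *m B1).
        by rewrite Dv -[D1 *m A]scale1r combD rmorph1 !scale1r.
      by rewrite opprD addrA [RHS]addrAC subrK.
    by apply: subspaceD => //; [apply: VW | apply/hA; rewrite submxMl].
  move=> c Wc; apply: (mulB0 _ _ B1); first exact: row_base_free.
  apply/eqP; rewrite -submx0 -(capmx_compl A) sub_capmx; apply/andP; split.
    by apply/hA; rewrite comb_mul; under eq_bigr do rewrite mxE.
  by rewrite (submx_trans (submxMl _ _)) // eq_row_base.
have -> : \rank A = #|'I_(\rank A)| by rewrite card_ord.
apply: (qbasis_qdim (e := fun i => comb (row i B2))) => //; split.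
- by move=> i; apply/hA; rewrite (submx_trans (row_sub _ _)) // eq_row_base.
- move=> w Ww; have [v Vv] := span' w (WU w Ww).
  have : (v <= B2)%MS.
    rewrite eq_row_base; apply/hA; rewrite -[comb v](subKr w).
    by apply: subspaceB => //; apply: VW.
  by case/submxP => D Dv; exists (fun j => D 0 j); rewrite -comb_mul -Dv.
move=> c Vc; apply: (mulB0 _ _ B2); first exact: row_base_free.
by apply: indep'; rewrite comb_mul; under eq_bigr do rewrite mxE.
Qed.

Lemma qdim0 U V : subspace V -> (forall x, U x -> V x) -> qdim U V 0.
Proof.
move=> sV UV; have <- : #|{: 'I_0}| = 0%N by rewrite card_ord.
apply: (qbasis_qdim (e := fun _ : 'I_0 => 0)) => //.
split=> [[]//|u Uu|c _ []//]; exists (fun=> 0).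
by rewrite big_ord0 subr0; apply: UV.
Qed.

End Subspaces.

(** Relations are used instead of maps: a homomorphism out of a submodule of
    R^n is not given as a map on the ambient vector space. *)
Definition linrel (E1 E2 : lmodType L) (G : E1 -> E2 -> Prop) : Prop :=
  G 0 0 /\ forall (c : F) u1 v1 u2 v2,
    G u1 u2 -> G v1 v2 -> G (emb c *: u1 + v1) (emb c *: u2 + v2).

Lemma qdim_rel (E1 E2 : lmodType L) (G : E1 -> E2 -> Prop)
    (U1 V1 : E1 -> Prop) (U2 V2 : E2 -> Prop) m :
  subspace U1 -> subspace V1 -> subspace U2 -> subspace V2 -> linrel G ->
  (forall u1, U1 u1 -> exists2 u2, U2 u2 & G u1 u2) ->
  (forall u2, U2 u2 -> exists2 u1, U1 u1 & G u1 u2) ->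
  (forall u1 u2, U1 u1 -> U2 u2 -> G u1 u2 -> V1 u1 <-> V2 u2) ->
  qdim U1 V1 m -> qdim U2 V2 m.
Proof.
move=> sU1 sV1 sU2 sV2 [G0 GD] tot surj GV.
case/(qdim_qbasis sU1 sV1) => e [Ue span indep].
have /fin_all_exists2[e' Ue' Ge] : forall i, exists2 u, U2 u & G (e i) u.
  by move=> i; apply/tot/Ue.
have Gsum (c : 'I_m -> F) :
    G (\sum_j emb (c j) *: e j) (\sum_j emb (c j) *: e' j).
  by elim/big_rec2: _ => // j x y _; apply: GD.
have -> : m = #|'I_m| by rewrite card_ord.
apply: (qbasis_qdim (e := e')) => //; split=> // [u U2u|c].
  have [u1 U1u1 Gu] := surj u U2u; have [c Vc] := span _ U1u1.
  exists c; apply/(GV (u1 - \sum_j emb (c j) *: e j)) => //.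
  - by apply: subspaceB => //; apply: subspace_sum.
  - by apply: subspaceB => //; apply: subspace_sum.
  - rewrite [u1 - _]addrC [u - _]addrC -2!scaleN1r -(rmorph1 emb) -rmorphN.
    exact: GD.
move/(GV _ _ (subspace_sum c sU1 Ue) (subspace_sum c sU2 Ue') (Gsum c)).
exact: indep.
Qed.

Lemma qdim_iso (E1 E2 : lmodType L) (G : E1 -> E2 -> Prop)
    (U1 V1 : E1 -> Prop) (U2 V2 : E2 -> Prop) m :
  subspace U1 -> subspace V1 -> subspace U2 -> subspace V2 -> linrel G ->
  (forall u1, U1 u1 -> exists2 u2, U2 u2 & G u1 u2) ->
  (forall u2, U2 u2 -> exists2 u1, U1 u1 & G u1 u2) ->
  (forall u1 u2, U1 u1 -> U2 u2 -> G u1 u2 -> V1 u1 <-> V2 u2) ->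
  qdim U1 V1 m <-> qdim U2 V2 m.
Proof.
move=> sU1 sV1 sU2 sV2 linG tot surj GV; split.
  exact: (qdim_rel sU1 sV1 sU2 sV2 linG).
have [G0 GD] := linG.
apply: (qdim_rel (G := fun y x => G x y)) => //.
- by split=> // c u1 v1 u2 v2; apply: GD.
- by move=> u2 u1 U2u2 U1u1 Gu; apply: iff_sym; apply: GV.
Qed.

Lemma qdim_ext (E : lmodType L) (U V U' V' : E -> Prop) m :
  (forall x, U x <-> U' x) -> (forall x, V x <-> V' x) ->
  qdim U V m <-> qdim U' V' m.
Proof.
move=> UU VV; split=> -[e [Ue h]].
  exists e; split=> [i|u /UU/h[c [Vc uc]]]; first exact/UU.
  by exists c; split=> [|c' /VV]; [apply/VV | apply: uc].
exists e; split=> [i|u /UU/h[c [Vc uc]]]; first exact/UU.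
by exists c; split=> [|c' /VV]; [apply/VV | apply: uc].
Qed.

Lemma linrel_mod (E : lmodType L) (V : E -> Prop) :
  subspace V -> linrel (fun x y => V (x - y)).
Proof.
case=> V0 Vl; split=> [|c u1 v1 u2 v2 Vu Vv]; first by rewrite subrr.
by rewrite opprD addrACA -scalerBr; apply: Vl.
Qed.

(** The second isomorphism theorem, through congruence modulo V. *)
Lemma qdim_cap_sum (E : lmodType L) (U V : E -> Prop) m :
  subspace U -> subspace V ->
  qdim U (cap_space U V) m <-> qdim (sum_space U V) V m.
Proof.
move=> sU sV; have sUV := sum_space_subspace sU sV; have sI := cap_space_subspace sU sV.
have inU u : U u -> sum_space U V u by apply: sum_space_l.
apply: (qdim_iso (G := fun x y => V (x - y))) => //.
- exact: linrel_mod.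
- by move=> u Uu; exists u; [apply: inU | rewrite subrr; case: sV].
- move=> _ [u [v [Uu Vv ->]]]; exists u => //.
  by rewrite opprD addrA subrr sub0r; apply: subspaceN.
- move=> u w Uu _ Vuw; split=> [[_ Vu]|Vw].
    by rewrite -[w](subKr u); apply: subspaceB.
  by split=> //; apply: subspaceBl Vuw Vw.
Qed.

End RelativeDimension.

(** * Euler characteristics of subquotient complexes *)

Section Complexes.

Variables (F : fieldType) (L : nzRingType) (emb : {rmorphism F -> L}).

Local Notation subspace := (subspace emb).
Local Notation qdim := (qdim emb).

Definition differential (E : lmodType L) (D : E -> E) : Prop :=
  (forall c u v, D (emb c *: u + v) = emb c *: D u + D v) /\
  forall x, D (D x) = 0.

Definition subcomplex (E : lmodType L) (D : E -> E) (C : nat -> E -> Prop) :=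
  (forall p, subspace (C p)) /\ (forall p x, C p x -> C p.+1 (D x)).

(** A pair C' <= C of subcomplexes stands for the quotient complex C/C', and
    its cocycles and coboundaries are represented in the ambient space. *)
Definition cocycles (E : lmodType L) (D : E -> E) (C C' : nat -> E -> Prop) p x :=
  C p x /\ C' p.+1 (D x).

Definition coboundaries (E : lmodType L) (D : E -> E) (C C' : nat -> E -> Prop) p x :=
  if p is q.+1 then exists b, C q b /\ C' p (x - D b) else C' p x.

(** Degrees from 4 on are left out: the standard cover of P^3 has four open
    sets. *)
Definition chi (E : lmodType L) (D : E -> E) (C C' : nat -> E -> Prop) (z : int) :=
  exists h : nat -> nat,
    (forall p, (p < 4)%N -> qdim (cocycles D C C' p) (coboundaries D C C' p) (h p))
    /\ z = \sum_(p < 4) (-1) ^+ p * (h p)%:Z.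

Section Basics.

Variables (E : lmodType L) (D : E -> E).
Hypothesis dD : differential D.
Implicit Types (A C : nat -> E -> Prop).

Lemma diffD u v : D (u + v) = D u + D v.
Proof. by case: dD => h _; have := h 1 u v; rewrite rmorph1 !scale1r. Qed.

Lemma diff0 : D 0 = 0.
Proof. by apply: (addrI (D 0)); rewrite -diffD !addr0. Qed.

Lemma diffZ c u : D (emb c *: u) = emb c *: D u.
Proof. by case: dD => h _; have := h c u 0; rewrite diff0 !addr0. Qed.

Lemma diffN u : D (- u) = - D u.
Proof. by rewrite -scaleN1r -(rmorph1 emb) -rmorphN diffZ rmorphN rmorph1 scaleN1r. Qed.

Lemma diffB u v : D (u - v) = D u - D v.
Proof. by rewrite diffD diffN. Qed.

Lemma diffK x : D (D x) = 0.
Proof. by case: dD. Qed.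

Lemma cocycles_subspace C C' p : subcomplex D C -> subcomplex D C' ->
  subspace (cocycles D C C' p).
Proof.
move=> [sC _] [sC' _]; have [C0 Cl] := sC p; have [C'0 C'l] := sC' p.+1.
split; first by split=> //; rewrite diff0.
move=> c u v [Cu Du] [Cv Dv]; split; first exact: Cl.
by rewrite diffD diffZ; apply: C'l.
Qed.

Lemma coboundaries_subspace C C' p : subcomplex D C -> subcomplex D C' ->
  subspace (coboundaries D C C' p).
Proof.
move=> [sC _] [sC' _]; case: p => [|p] /=; first exact: sC'.
have [C0 Cl] := sC p; have [C'0 C'l] := sC' p.+1.
split; first by exists 0; rewrite diff0 subr0.
move=> c u v [b [Cb Cu]] [b' [Cb' Cv]]; exists (emb c *: b + b').
split; first exact: Cl.
by rewrite diffD diffZ opprD addrACA -scalerBr; apply: C'l.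
Qed.

Lemma sub_coboundaries C C' p x : subcomplex D C -> C' p x -> coboundaries D C C' p x.
Proof.
case=> sC _ Cx; case: p Cx => //= p Cx; exists 0.
by rewrite diff0 subr0; case: (sC p).
Qed.

End Basics.

Section LongExactSequence.

Variables (E : lmodType L) (D : E -> E).
Hypothesis dD : differential D.
Variables A0 A1 A2 : nat -> E -> Prop.
Hypotheses (cA0 : subcomplex D A0) (cA1 : subcomplex D A1)
  (cA2 : subcomplex D A2).
Hypotheses (A01 : forall p x, A0 p x -> A1 p x)
  (A12 : forall p x, A1 p x -> A2 p x).
Hypothesis A2_4 : forall x, A2 4 x -> x = 0.

Local Notation Z C C' := (cocycles D C C').
Local Notation B C C' := (coboundaries D C C').
Local Notation H C C' p := (qdim (Z C C' p) (B C C' p)).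

Let sA0 p : subspace (A0 p). Proof. by case: cA0. Qed.
Let sA1 p : subspace (A1 p). Proof. by case: cA1. Qed.
Let sA2 p : subspace (A2 p). Proof. by case: cA2. Qed.
Let D0 p x : A0 p x -> A0 p.+1 (D x). Proof. by case: cA0 => _; apply. Qed.
Let D1 p x : A1 p x -> A1 p.+1 (D x). Proof. by case: cA1 => _; apply. Qed.
Let D2 p x : A2 p x -> A2 p.+1 (D x). Proof. by case: cA2 => _; apply. Qed.

Let sZ10 p : subspace (Z A1 A0 p). Proof. exact: cocycles_subspace. Qed.
Let sZ20 p : subspace (Z A2 A0 p). Proof. exact: cocycles_subspace. Qed.
Let sZ21 p : subspace (Z A2 A1 p). Proof. exact: cocycles_subspace. Qed.
Let sB10 p : subspace (B A1 A0 p). Proof. exact: coboundaries_subspace. Qed.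
Let sB20 p : subspace (B A2 A0 p). Proof. exact: coboundaries_subspace. Qed.
Let sB21 p : subspace (B A2 A1 p). Proof. exact: coboundaries_subspace. Qed.

(** The long exact sequence of the pairs (A1, A0), (A2, A0), (A2, A1) is cut at
    the map from the cohomology of A1/A0 to that of A2/A0, in each degree: its
    kernel, its image, and the cokernel, which is also the image in the
    cohomology of A2/A1. *)
Definition ker_dim p := qdim (cap_space (Z A1 A0 p) (B A2 A0 p)) (B A1 A0 p).
Definition im_dim p := qdim (Z A1 A0 p) (cap_space (Z A1 A0 p) (B A2 A0 p)).
Definition coker_dim p := qdim (Z A2 A0 p) (sum_space (Z A1 A0 p) (B A2 A0 p)).

Lemma B10_cap p x : B A1 A0 p x -> cap_space (Z A1 A0 p) (B A2 A0 p) x.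
Proof.
case: p => [|p] /=.
  by move=> Ax; split=> //; split; [apply: A01 | apply: D0].
case=> b [Ab Axb]; split; last by exists b; split=> //; apply: A12.
split; first by apply: subspaceBl (D1 Ab) => //; apply: A01.
by rewrite -[D x]subr0 -(diffK dD b) -(diffB dD); apply: D0.
Qed.

Lemma B20_Z20 p x : B A2 A0 p x -> Z A2 A0 p x.
Proof.
case: p => [|p] /=.
  by move=> Ax; split; [apply/A12/A01 | apply: D0].
case=> b [Ab Axb]; split; first by apply: subspaceBl (D2 Ab) => //; apply/A12/A01.
by rewrite -[D x]subr0 -(diffK dD b) -(diffB dD); apply: D0.
Qed.

Lemma sum_Z20 p x : sum_space (Z A1 A0 p) (B A2 A0 p) x -> Z A2 A0 p x.
Proof.
case=> u [v [[Au Du] /B20_Z20 Zv ->]]; apply: (subspaceD (sZ20 p)) => //.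
by split=> //; apply: A12.
Qed.

Lemma cohom10 p m : H A1 A0 p m <->
  exists a b, [/\ ker_dim p a, im_dim p b & m = (a + b)%N].
Proof.
have sI : subspace (cap_space (Z A1 A0 p) (B A2 A0 p)) by apply: cap_space_subspace.
split=> [|[a [b [ha hb ->]]]].
  case/(qdim_split (sZ10 p) sI (sB10 p) (@B10_cap p)) => [x [[]//]|b [a [hb ha ->]]].
  by exists a, b; rewrite addnC.
rewrite addnC; apply: (qdim_add (sZ10 p) sI (sB10 p) (@B10_cap p)) => // x [] //.
Qed.

Lemma cohom20 p m : H A2 A0 p m <->
  exists b c, [/\ im_dim p b, coker_dim p c & m = (b + c)%N].
Proof.
have sS : subspace (sum_space (Z A1 A0 p) (B A2 A0 p)) by apply: sum_space_subspace.
have inS x : B A2 A0 p x -> sum_space (Z A1 A0 p) (B A2 A0 p) x by apply: sum_space_r.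
have im_sum b : im_dim p b <-> _ := qdim_cap_sum b (sZ10 p) (sB20 p).
split=> [|[b [c [/im_sum hb hc ->]]]].
  case/(qdim_split (sZ20 p) sS (sB20 p) inS (@sum_Z20 p)) => c [b [hc hb ->]].
  by exists b, c; rewrite addnC; split=> //; apply/im_sum.
by rewrite addnC; apply: qdim_add hc hb => //; apply: sum_Z20.
Qed.

Lemma cap_Z20_B21 p x :
  cap_space (Z A2 A0 p) (B A2 A1 p) x <-> sum_space (Z A1 A0 p) (B A2 A0 p) x.
Proof.
split=> [[[Ax Dx] Bx]|Sx]; last first.
  split; first exact: sum_Z20.
  case: Sx => u [v [[Au _] Bv ->]]; apply: (subspaceD (sB21 p)).
    exact: sub_coboundaries.
  case: p Bv {Au} => [|p] /=; first exact: A01.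
  by case=> b [Ab Avb]; exists b; split=> //; apply: A01.
case: p Ax Dx Bx => [|p] Ax Dx /=; first by move=> ?; apply: sum_space_l.
case=> b [Ab Axb]; exists (x - D b), (D b); split; last by rewrite subrK.
  by split=> //; rewrite (diffB dD) (diffK dD) subr0.
by exists b; split=> //; rewrite subrr; case: (sA0 p.+1).
Qed.

(** The differential itself induces the connecting homomorphism, which
    identifies what is missing in the image of the cohomology of A2/A0 with the
    next kernel. *)
Lemma connecting p a : ker_dim p.+1 a <->
  qdim (Z A2 A1 p) (sum_space (Z A2 A0 p) (B A2 A1 p)) a.
Proof.
have sS : subspace (sum_space (Z A2 A0 p) (B A2 A1 p)) by apply: sum_space_subspace.
apply: iff_sym; apply: (qdim_iso (G := fun x y => B A1 A0 p.+1 (y - D x))) => //.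
- exact: cap_space_subspace.
- split; first by rewrite (diff0 dD) subr0; case: (sB10 p.+1).
  move=> c u1 v1 u2 v2 h h'; rewrite (diffD dD) (diffZ dD) opprD addrACA.
  by rewrite -scalerBr; case: (sB10 p.+1) => _; apply.
- move=> x [Ax Dx]; exists (D x); last by rewrite subrr; case: (sB10 p.+1).
  split; first by split=> //; rewrite (diffK dD); case: (sA0 p.+2).
  by exists x; rewrite subrr; split=> //; case: (sA0 p.+1).
- move=> y [[Ay Dy] [b [Ab Ayb]]]; exists b; last exact: sub_coboundaries.
  by split=> //; rewrite -[D b](subKr y); apply: subspaceB => //; apply: A01.
move=> x y [Ax Dx] Uy [b [Ab Ayb]]; split.
  case=> z [w [[Az Dz] Bw xE]].
  (* A coboundary of A2/A1 has the same differential as an element of A1. *)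
  have [b' Ab' Db'] : exists2 b', A1 p b' & D b' = D w.
    case: p Bw {Ax Dx Uy b Ab Ayb Az Dz sS} => [|p] /=; first by exists w.
    by case=> d [Ad Awd]; exists (w - D d); rewrite // (diffB dD) (diffK dD) subr0.
  exists (b + b'); split; first exact: subspaceD.
  have -> : y - D (b + b') = (y - D x - D b) + D z.
    rewrite xE !(diffD dD) Db' [D z + _]addrC !opprD !addrA.
    by rewrite [RHS]addrAC subrK addrAC.
  exact: subspaceD.
case=> d [Ad Ayd].
have Abd : A1 p (d - b) by apply: subspaceB.
rewrite -[x](subrK (d - b)); exists (x - (d - b)), (d - b); split=> //.
  split; first by apply: subspaceB => //; apply: A12.
  have -> : D (x - (d - b)) = (y - D d) - (y - D x - D b).
    rewrite !(diffB dD) -[y - D x - D b]addrA -opprD !opprB.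
    by rewrite [RHS]addrC [RHS]addrA subrK addrA.
  exact: subspaceB.
exact: sub_coboundaries.
Qed.

Lemma cohom21 p m : H A2 A1 p m <->
  exists c a, [/\ coker_dim p c, ker_dim p.+1 a & m = (c + a)%N].
Proof.
have sS : subspace (sum_space (Z A2 A0 p) (B A2 A1 p)) by apply: sum_space_subspace.
have inS x : B A2 A1 p x -> sum_space (Z A2 A0 p) (B A2 A1 p) x by apply: sum_space_r.
have SZ x : sum_space (Z A2 A0 p) (B A2 A1 p) x -> Z A2 A1 p x.
  case=> u [v [[Au Du] Bv ->]]; apply: (subspaceD (sZ21 p)).
    by split=> //; apply: A01.
  case: p Bv {Au Du sS inS} => [|p] /=.
    by move=> Av; split; [apply: A12 | apply: D1].
  case=> b [Ab Avb]; split; first by apply: subspaceBl (D2 Ab) => //; apply: A12.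
  by rewrite -[D v]subr0 -(diffK dD b) -(diffB dD); apply: D1.
have cokerE c : coker_dim p c <-> qdim (sum_space (Z A2 A0 p) (B A2 A1 p)) (B A2 A1 p) c.
  apply: iff_trans (qdim_cap_sum c (sZ20 p) (sB21 p)).
  by apply: qdim_ext => // x; apply: iff_sym; apply: cap_Z20_B21.
split=> [|[c [a [/cokerE hc /connecting ha ->]]]].
  case/(qdim_split (sZ21 p) sS (sB21 p) inS SZ) => a [c [ha hc ->]].
  by exists c, a; rewrite addnC; split=> //; [apply/cokerE | apply/connecting].
by rewrite addnC; apply: qdim_add ha hc.
Qed.

Lemma ker_dim0 : ker_dim 0 0.
Proof. by apply: qdim0 => // x [_]. Qed.

Lemma ker_dim4 : ker_dim 4 0.
Proof.
apply: qdim0 => // x [[/A12/A2_4 -> _] _]; exists 0.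
by rewrite (diff0 dD) subr0; case: (sA0 4); case: (sA1 3).
Qed.

Let sI p : subspace (cap_space (Z A1 A0 p) (B A2 A0 p)).
Proof. exact: cap_space_subspace. Qed.
Let sS p : subspace (sum_space (Z A1 A0 p) (B A2 A0 p)).
Proof. exact: sum_space_subspace. Qed.

Lemma ker_dim_uniq p a a' : ker_dim p a -> ker_dim p a' -> a = a'.
Proof. exact: qdim_uniq. Qed.
Lemma im_dim_uniq p a a' : im_dim p a -> im_dim p a' -> a = a'.
Proof. exact: qdim_uniq. Qed.
Lemma coker_dim_uniq p a a' : coker_dim p a -> coker_dim p a' -> a = a'.
Proof. exact: qdim_uniq. Qed.

Lemma chi_intro (C C' : nat -> E -> Prop) (h0 h1 h2 h3 : nat) z :
  H C C' 0 h0 -> H C C' 1 h1 -> H C C' 2 h2 -> H C C' 3 h3 ->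
  z = h0%:Z - h1%:Z + h2%:Z - h3%:Z -> chi D C C' z.
Proof.
move=> H0 H1 H2 H3 ->; exists (fun p => nth 0%N [:: h0; h1; h2; h3] p).
by split=> [[|[|[|[|[]]]]] //|]; rewrite !big_ord_recl big_ord0 /= /bump /=; ring.
Qed.

Lemma chi_elim (C C' : nat -> E -> Prop) z : chi D C C' z ->
  exists h0 h1 h2 h3 : nat, [/\ H C C' 0 h0, H C C' 1 h1, H C C' 2 h2, H C C' 3 h3
    & z = h0%:Z - h1%:Z + h2%:Z - h3%:Z].
Proof.
move=> [h [hh ->]]; exists (h 0%N), (h 1%N), (h 2%N), (h 3%N).
split; try exact: hh.
by rewrite !big_ord_recl big_ord0 /= /bump /=; ring.
Qed.

(** In each of the three alternating sums the pieces are determined by the two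
    given ones; the outermost kernels, in degrees 0 and 4, vanish, and the
    other ones cancel between consecutive degrees. *)
Lemma chi_sub z2 z3 : chi D A2 A0 z2 -> chi D A2 A1 z3 -> chi D A1 A0 (z2 - z3).
Proof.
case/chi_elim=> ? [? [? [? [/cohom20[b0 [c0 [hb0 hc0 ->]]]
  /cohom20[b1 [c1 [hb1 hc1 ->]]] /cohom20[b2 [c2 [hb2 hc2 ->]]]
  /cohom20[b3 [c3 [hb3 hc3 ->]]] ->]]]].
case/chi_elim=> ? [? [? [? [/cohom21[c0' [a1 [hc0' ha1 ->]]]
  /cohom21[c1' [a2 [hc1' ha2 ->]]] /cohom21[c2' [a3 [hc2' ha3 ->]]]
  /cohom21[c3' [a4 [hc3' ha4 ->]]] ->]]]].
rewrite -(coker_dim_uniq hc0 hc0') -(coker_dim_uniq hc1 hc1').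
rewrite -(coker_dim_uniq hc2 hc2') -(coker_dim_uniq hc3 hc3').
rewrite (ker_dim_uniq ha4 ker_dim4).
apply: (@chi_intro _ _ (0 + b0) (a1 + b1) (a2 + b2) (a3 + b3)); last by lia.
- by apply/cohom10; exists 0%N, b0; split=> //; apply: ker_dim0.
- by apply/cohom10; exists a1, b1.
- by apply/cohom10; exists a2, b2.
- by apply/cohom10; exists a3, b3.
Qed.

Lemma chi_quot z1 z2 : chi D A1 A0 z1 -> chi D A2 A0 z2 -> chi D A2 A1 (z2 - z1).
Proof.
case/chi_elim=> ? [? [? [? [/cohom10[a0 [b0' [ha0 hb0' ->]]]
  /cohom10[a1 [b1' [ha1 hb1' ->]]] /cohom10[a2 [b2' [ha2 hb2' ->]]]
  /cohom10[a3 [b3' [ha3 hb3' ->]]] ->]]]].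
case/chi_elim=> ? [? [? [? [/cohom20[b0 [c0 [hb0 hc0 ->]]]
  /cohom20[b1 [c1 [hb1 hc1 ->]]] /cohom20[b2 [c2 [hb2 hc2 ->]]]
  /cohom20[b3 [c3 [hb3 hc3 ->]]] ->]]]].
rewrite -(im_dim_uniq hb0 hb0') -(im_dim_uniq hb1 hb1').
rewrite -(im_dim_uniq hb2 hb2') -(im_dim_uniq hb3 hb3').
rewrite (ker_dim_uniq ha0 ker_dim0).
apply: (@chi_intro _ _ (c0 + a1) (c1 + a2) (c2 + a3) (c3 + 0)); last by lia.
- by apply/cohom21; exists c0, a1.
- by apply/cohom21; exists c1, a2.
- by apply/cohom21; exists c2, a3.
- by apply/cohom21; exists c3, 0%N; split=> //; apply: ker_dim4.
Qed.

Lemma chi_add z1 z3 : chi D A1 A0 z1 -> chi D A2 A1 z3 -> chi D A2 A0 (z1 + z3).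
Proof.
case/chi_elim=> ? [? [? [? [/cohom10[a0 [b0 [ha0 hb0 ->]]]
  /cohom10[a1 [b1 [ha1 hb1 ->]]] /cohom10[a2 [b2 [ha2 hb2 ->]]]
  /cohom10[a3 [b3 [ha3 hb3 ->]]] ->]]]].
case/chi_elim=> ? [? [? [? [/cohom21[c0 [a1' [hc0 ha1' ->]]]
  /cohom21[c1 [a2' [hc1 ha2' ->]]] /cohom21[c2 [a3' [hc2 ha3' ->]]]
  /cohom21[c3 [a4 [hc3 ha4 ->]]] ->]]]].
rewrite -(ker_dim_uniq ha1 ha1') -(ker_dim_uniq ha2 ha2').
rewrite -(ker_dim_uniq ha3 ha3') (ker_dim_uniq ha0 ker_dim0).
rewrite (ker_dim_uniq ha4 ker_dim4).
apply: (@chi_intro _ _ (b0 + c0) (b1 + c1) (b2 + c2) (b3 + c3)); last by lia.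
- by apply/cohom20; exists b0, c0.
- by apply/cohom20; exists b1, c1.
- by apply/cohom20; exists b2, c2.
- by apply/cohom20; exists b3, c3.
Qed.

End LongExactSequence.

(** A relation that is total on both sides, compatible with the differentials
    and matches the two subcomplexes induces isomorphisms in cohomology. *)
Lemma chi_iso (E1 E2 : lmodType L) (D1 : E1 -> E1) (D2 : E2 -> E2)
    (G : E1 -> E2 -> Prop) (C1 C1' : nat -> E1 -> Prop) (C2 C2' : nat -> E2 -> Prop)
    (z : int) :
  differential D1 -> differential D2 ->
  subcomplex D1 C1 -> subcomplex D1 C1' -> subcomplex D2 C2 -> subcomplex D2 C2' ->
  linrel emb G -> (forall x y, G x y -> G (D1 x) (D2 y)) ->
  (forall p x, C1 p x -> exists2 y, C2 p y & G x y) ->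
  (forall p y, C2 p y -> exists2 x, C1 p x & G x y) ->
  (forall p x y, C1 p x -> C2 p y -> G x y -> C1' p x <-> C2' p y) ->
  chi D1 C1 C1' z <-> chi D2 C2 C2' z.
Proof.
move=> dD1 dD2 cC1 cC1' cC2 cC2' linG GD tot surj GC.
suff H p m : qdim (cocycles D1 C1 C1' p) (coboundaries D1 C1 C1' p) m <->
             qdim (cocycles D2 C2 C2' p) (coboundaries D2 C2 C2' p) m.
  by split=> -[h [hh ->]]; exists h; split=> // p /hh/H.
have DC1 q x : C1 q x -> C1 q.+1 (D1 x) by case: cC1 => _; apply.
have DC2 q x : C2 q x -> C2 q.+1 (D2 x) by case: cC2 => _; apply.
apply: (qdim_iso (G := G)) => //; try exact: cocycles_subspace;
  try exact: coboundaries_subspace.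
- move=> x [Cx Dx]; have [y Cy Gxy] := tot p x Cx; exists y => //; split=> //.
  by apply/(GC p.+1 (D1 x)); auto.
- move=> y [Cy Dy]; have [x Cx Gxy] := surj p y Cy; exists x => //; split=> //.
  by apply/(GC p.+1 _ (D2 y)); auto.
move=> x y [Cx _] [Cy _] Gxy; case: p Cx Cy => [|p] Cx Cy; first exact: GC.
have Gsub b b' : G b b' -> G (x - D1 b) (y - D2 b').
  move/GD => Gb; rewrite [x - _]addrC [y - _]addrC -2!scaleN1r -(rmorph1 emb) -rmorphN.
  by case: linG => _; apply.
have sub1 b : C1 p b -> C1 p.+1 (x - D1 b).
  by move=> Cb; case: cC1 => s1 _; apply: (subspaceB (s1 p.+1)) => //; apply: DC1.
have sub2 b : C2 p b -> C2 p.+1 (y - D2 b).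
  by move=> Cb; case: cC2 => s2 _; apply: (subspaceB (s2 p.+1)) => //; apply: DC2.
split=> -[b [Cb Cxb]].
  have [b' Cb' Gb] := tot p b Cb; exists b'; split=> //.
  by apply/(GC _ _ _ (sub1 b Cb) (sub2 b' Cb') (Gsub _ _ Gb)).
have [b' Cb' Gb] := surj p b Cb; exists b'; split=> //.
by apply/(GC _ _ _ (sub1 b' Cb') (sub2 b Cb) (Gsub _ _ Gb)).
Qed.

Lemma chi_ext (E : lmodType L) (D : E -> E) (C1 C1' C2 C2' : nat -> E -> Prop) z :
  (forall p x, C1 p x <-> C2 p x) -> (forall p x, C1' p x <-> C2' p x) ->
  chi D C1 C1' z <-> chi D C2 C2' z.
Proof.
move=> C12 C12'.
suff H p m : qdim (cocycles D C1 C1' p) (coboundaries D C1 C1' p) m <->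
             qdim (cocycles D C2 C2' p) (coboundaries D C2 C2' p) m.
  by split=> -[h [hh ->]]; exists h; split=> // p /hh/H.
apply: qdim_ext => x; first by split=> -[/C12 h /C12' h'].
case: p => [|p] /=; first exact: C12'.
by split=> -[b [/C12 h /C12' h']]; exists b.
Qed.

End Complexes.

(** * Sections over the standard open sets *)

Section ProjectiveSpace.

Variable k : fieldType.

Local Notation R := {mpoly k[4]}.
Local Notation K := {fraction {mpoly k[4]}}.
Local Notation tf := (@FracField.tofrac {mpoly k[4]}).

Definition const_frac : {rmorphism k -> K} := tf \o @mpolyC 4 k.

Lemma homogz0 z : homogz z (0 : R).
Proof. by case: z => // d; apply: rpred0. Qed.

Lemma homogzD z (p q : R) : homogz z p -> homogz z q -> homogz z (p + q).
Proof. by case: z => [d|d] /=; [apply: rpredD | move=> -> ->; rewrite addr0]. Qed.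

Lemma homogz_sum z (J : finType) (p : J -> R) :
  (forall j, homogz z (p j)) -> homogz z (\sum_j p j).
Proof. by move=> h; elim/big_ind: _ => //; [apply: homogz0 | apply: homogzD]. Qed.

Lemma homogzM d z (p q : R) :
  p \is d.-homog -> homogz z q -> homogz (d%:Z + z) (p * q).
Proof.
case: z => [e|e] /= hp; first exact: dhomogM.
by move=> ->; rewrite mulr0; apply: homogz0.
Qed.

Lemma homog_x_prod S N : (x_prod k S ^+ N : R) \is (N * #|S|)%N.-homog.
Proof.
rewrite mulnC; apply: dhomogMn.
rewrite /x_prod mprodXE dhomogX /= mdeg_sum (eq_bigr (fun=> 1%N)) ?sum1_card //.
by move=> i _; rewrite mdeg1.
Qed.

Lemma x_prod_neq0 S N : (x_prod k S ^+ N : R) != 0.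
Proof.
by rewrite expf_neq0 // /x_prod mprodXE -msupp_eq0 msuppX.
Qed.

Lemma tf_x_prod_neq0 S N : tf (x_prod k S ^+ N) != 0.
Proof. by rewrite tofrac_eq0 x_prod_neq0. Qed.

Lemma map_tfD n (u v : 'cV[R]_n) : map_mx tf (u + v) = map_mx tf u + map_mx tf v.
Proof. exact: raddfD. Qed.

Lemma map_tfZ n r (v : 'cV[R]_n) : map_mx tf (r *: v) = tf r *: map_mx tf v.
Proof. by apply/matrixP => i j; rewrite !mxE rmorphM. Qed.

Lemma map_tf_inj n (u v : 'cV[R]_n) : map_mx tf u = map_mx tf v -> u = v.
Proof.
move/matrixP => h; apply/matrixP => i j.
by have := h i j; rewrite !mxE => /eqP; rewrite tofrac_eq => /eqP.
Qed.

Section Modules.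

Variables (n : nat) (a : 'I_n -> int).
Implicit Types (A B : 'cV[R]_n -> Prop) (t : int) (S : {set 'I_4}) (v : 'cV[K]_n).

Definition submodule A : Prop :=
  A 0 /\ forall (r : R) (u v : 'cV[R]_n), A u -> A v -> A (r *: u + v).

Lemma submodD A (u v : 'cV[R]_n) : submodule A -> A u -> A v -> A (u + v).
Proof. by case=> _ h Au Av; rewrite -[u]scale1r; apply: h. Qed.

Lemma submodZ A r u : submodule A -> A u -> A (r *: u).
Proof. by case=> A0 h Au; rewrite -[_ *: _]addr0; apply: h. Qed.

Lemma graded_pieceD z (u v : 'cV[R]_n) :
  graded_piece a z u -> graded_piece a z v -> graded_piece a z (u + v).
Proof. by move=> hu hv j; rewrite mxE; apply: homogzD. Qed.

Lemma graded_pieceZ d z r (u : 'cV[R]_n) :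
  r \is d.-homog -> graded_piece a z u -> graded_piece a (d%:Z + z) (r *: u).
Proof. by move=> hr hu j; rewrite mxE -addrA; apply: homogzM. Qed.

(** Sections with a prescribed exponent in the denominator, so that two
    sections can be brought to a common one. *)
Definition section_at A t S N v : Prop := exists w : 'cV[R]_n,
  [/\ A w, graded_piece a ((N * #|S|)%N%:Z + t) w
    & map_mx tf w = tf (x_prod k S ^+ N) *: v].

Lemma section_atS A t S N M v :
  submodule A -> section_at A t S N v -> section_at A t S (M + N) v.
Proof.
move=> sA [w [Aw gw ew]]; exists (x_prod k S ^+ M *: w); split.
- exact: submodZ.
- by rewrite mulnDl PoszD -addrA; apply: graded_pieceZ => //; apply: homog_x_prod.
- by rewrite map_tfZ ew scalerA -rmorphM -exprD.
Qed.

Lemma sections_subspace A t S : submodule A -> subspace const_frac (sections a A t S).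
Proof.
move=> sA; split.
  exists 0%N, 0; split; first by case: sA.
    by move=> j; rewrite mxE; apply: homogz0.
  by rewrite raddf0 scaler0.
move=> c u v [N [w hw]] [M [w' hw']].
have [w1 [Aw1 gw1 ew1]] : section_at A t S (M + N) u.
  by apply: section_atS => //; exists w.
have [w2 [Aw2 gw2 ew2]] : section_at A t S (M + N) v.
  by rewrite addnC; apply: section_atS => //; exists w'.
exists (M + N)%N, (c%:MP *: w1 + w2); split.
- by case: sA => _; apply.
- apply: graded_pieceD => //.
  rewrite -[_ + t]add0r; apply: graded_pieceZ => //.
  by rewrite -mul_mpolyC mulr1 || idtac; rewrite -alg_mpolyC; apply/dhomogZ/dhomog1.
- by rewrite map_tfD map_tfZ ew1 ew2 scalerDr !scalerA mulrC.
Qed.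

Lemma sections0 A t S : submodule A -> sections a A t S 0.
Proof. by move=> sA; case: (sections_subspace t S sA). Qed.

Lemma sections_restrict A t S S' v : S \subset S' ->
  submodule A -> sections a A t S v -> sections a A t S' v.
Proof.
move=> SS' sA [N [w [Aw gw ew]]].
have xS' : x_prod k S' = x_prod k (S' :\: S) * x_prod k S.
  rewrite /x_prod mulrC -bigU /=; last first.
    by rewrite disjoints_subset; apply/subsetP => i iS; rewrite !inE iS.
  by apply: eq_bigl => i; rewrite !inE; case: (boolP (i \in S)) => // /(subsetP SS') ->.
have cS' : #|S'| = (#|S' :\: S| + #|S|)%N by rewrite -(cardsID S S') (setIidPr SS') addnC.
exists N, (x_prod k (S' :\: S) ^+ N *: w); split.
- exact: submodZ.
- by rewrite cS' mulnDr PoszD -addrA; apply: graded_pieceZ => //; apply: homog_x_prod.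
- by rewrite map_tfZ ew scalerA -rmorphM -exprMn -xS'.
Qed.

Lemma sections_mono A B t S v : (forall w, A w -> B w) ->
  sections a A t S v -> sections a B t S v.
Proof. by move=> AB [N [w [Aw gw ew]]]; exists N, w; split; auto. Qed.

(** The numerator w of a section over D(x_S) is brought to degree 0 by a power
    of x_i, i in S; hence some x_i ^ N' w lies in B, and then so does
    x_S ^ N' w, which is another numerator of the same section. *)
Lemma same_subsheaf_sections A B t S v : submodule A -> submodule B ->
  same_subsheaf a A B -> S != set0 ->
  sections a A t S v -> sections a B t S v.
Proof.
move=> sA sB AB /set0Pn[i iS] [N [w [Aw gw ew]]].
set z := (N * #|S|)%N%:Z + t in gw.
have [N' BN'] : exists N', B ('X_i ^+ N' *: w).
  (* The degree z may be negative: multiplying by x_i ^ d2 and dividing by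
     x_i ^ d1, where d1 = d2 + z, leads to degree 0 in both cases. *)
  pose d2 := absz z; pose d1 := absz (d2%:Z + z).
  have x1 M : x_prod k [set i] ^+ M = 'X_i ^+ M by rewrite /x_prod big_set1.
  have /AB[M [w' [Bw' _ ew']]] : sections a A 0 [set i]
      ((tf ('X_i ^+ d1))^-1 *: map_mx tf ('X_i ^+ d2 *: w)).
    exists d1, ('X_i ^+ d2 *: w); split; first exact: submodZ.
      rewrite cards1 muln1 (_ : _ + 0 = d2%:Z + z); last by rewrite /d1 /d2; lia.
      apply: graded_pieceZ => //; rewrite -x1.
      by have := homog_x_prod [set i] d2; rewrite cards1 muln1.
    by rewrite x1 scalerA divff ?scale1r // -x1 tf_x_prod_neq0.
  exists (M + d2)%N; rewrite (_ : _ *: w = 'X_i ^+ d1 *: w'); first exact: submodZ.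
  apply: map_tf_inj; rewrite [RHS]map_tfZ ew' x1 !scalerA mulrAC divff ?mul1r;
    last by rewrite -x1 tf_x_prod_neq0.
  by rewrite !map_tfZ scalerA -rmorphM -exprD.
exists (N' + N)%N, (x_prod k S ^+ N' *: w); split.
- rewrite /x_prod (big_setD1 i) //= exprMn mulrC -scalerA; exact: submodZ.
- by rewrite mulnDl PoszD -addrA; apply: graded_pieceZ => //; apply: homog_x_prod.
- by rewrite map_tfZ ew scalerA -rmorphM -exprD.
Qed.

End Modules.

(** * The Cech complex *)

Section Signs.

Variable T : comNzRingType.
Implicit Types (i j : 'I_4) (S : {set 'I_4}).

Definition sgn (i : 'I_4) (S : {set 'I_4}) : T :=
  (-1) ^+ #|[set j in S | (j < i)%N]|.

Lemma sgn_rem i j S : j \in S ->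
  sgn i (S :\ j) = if (j < i)%N then - sgn i S else sgn i S.
Proof.
move=> jS; rewrite /sgn; case: ifP => ji; last first.
  congr (_ ^+ #|pred_of_set _|); apply/setP => x; rewrite !inE.
  by case: eqP => //= ->; rewrite ji andbF.
rewrite [in RHS](cardsD1 j) !inE jS ji exprS mulN1r opprK.
by congr (_ ^+ #|pred_of_set _|); apply/setP => x; rewrite !inE andbA.
Qed.

Lemma sgn_add i j S : j \notin S ->
  sgn i (j |: S) = if (j < i)%N then - sgn i S else sgn i S.
Proof.
move=> jS; have := @sgn_rem i j (j |: S) (setU11 _ _).
by rewrite setU1K // => ->; case: (j < i)%N; rewrite ?opprK.
Qed.

Lemma sgn_self i S : sgn i (S :\ i) = sgn i S.
Proof.
rewrite /sgn; congr (_ ^+ #|pred_of_set _|); apply/setP => x; rewrite !inE.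
by case: eqP => //= ->; rewrite ltnn andbF.
Qed.

Lemma sgn_sq i S : sgn i S * sgn i S = 1.
Proof. by rewrite /sgn -exprD addnn -mul2n exprM sqrrN expr1n expr1n. Qed.

Lemma sgn_exchange i j S : i \in S -> j \in S -> i != j ->
  sgn i S * sgn j (S :\ i) = - (sgn j S * sgn i (S :\ j)).
Proof.
move=> iS jS ij; rewrite !sgn_rem //.
have [h|h|/val_inj h] := ltngtP i j.
- ring.
- ring.
- by rewrite h eqxx in ij.
Qed.

End Signs.

Section Modules.

Variables (n : nat).
Implicit Types (A B : 'cV[R]_n -> Prop) (t : int) (S : {set 'I_4}).
Local Notation E := {ffun {set 'I_4} -> 'cV[K]_n}.

Lemma cech_dE (c : E) S :
  cech_d c S = \sum_(i in S) sgn K i S *: c (S :\ i).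
Proof. by rewrite ffunE. Qed.

Lemma cech_differential : differential const_frac (@cech_d k n).
Proof.
split=> [c u v|c]; apply/ffunP => S.
  rewrite cech_dE ![in RHS]ffunE !scaler_sumr -big_split /=.
  by apply: eq_bigr => i _; rewrite !ffunE scalerDr !scalerA mulrC.
rewrite cech_dE [RHS]ffunE.
pose G (i j : 'I_4) := (sgn K i S * sgn K j (S :\ i)) *: c (S :\ i :\ j).
have -> : \sum_(i in S) sgn K i S *: cech_d c (S :\ i) =
    \sum_(i in S) \sum_(j in S | j != i) G i j.
  apply: eq_bigr => i iS; rewrite cech_dE scaler_sumr; apply: eq_big => j.
    by rewrite !inE andbC.
  by rewrite scalerA.
(* Splitting by i < j and j < i pairs (i, j) with (j, i), in any
   characteristic. *)
rewrite (eq_bigr (fun i : 'I_4 =>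
    \sum_(j : 'I_4 | (j \in S) && (i < j)%N) G i j
    + \sum_(j : 'I_4 | (j \in S) && (j < i)%N) G i j)); last first.
  move=> i iS; rewrite (bigID (fun j : 'I_4 => (i < j)%N)) /=; congr (_ + _).
    apply: eq_bigl => j; rewrite -andbA -(inj_eq val_inj) /=.
    by case: ltngtP; rewrite ?andbF.
  apply: eq_bigl => j; rewrite -andbA -(inj_eq val_inj) /=.
  by case: ltngtP; rewrite ?andbF.
rewrite big_split /= [X in _ + X](exchange_big_dep (mem S)) /=; last first.
  by move=> i j _ /andP[].
rewrite -big_split big1 //= => i iS.
rewrite [X in _ + X](eq_bigl (fun j : 'I_4 => (j \in S) && (i < j)%N)); last first.
  by move=> j; rewrite iS.
rewrite -big_split big1 //= => j /andP[jS ij].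
have nij : i != j by rewrite -(inj_eq val_inj) neq_ltn ij.
rewrite /G (sgn_exchange _ iS jS nij) scaleNr.
by rewrite !setDDl [[set i] :|: _]setUC addNr.
Qed.

Lemma cochain_subcomplex (a : 'I_n -> int) A t : submodule A ->
  subcomplex const_frac (@cech_d k n) (cochain a A t).
Proof.
move=> sA; split=> p.
  split=> [S|c u v Cu Cv S]; rewrite !ffunE.
    by case: ifP => // _; apply: sections0.
  have := Cu S; have := Cv S; case: ifP => _; last by move=> -> ->; rewrite scaler0 addr0.
  by move=> su sv; case: (sections_subspace a t S sA) => _; apply.
move=> c Cc S; rewrite cech_dE; case: ifP => [/eqP cS|cS].
  have sS := sections_subspace a t S sA.
  elim/big_ind: _ => [|x y sx sy|i iS]; first by case: sS.
    exact: (subspaceD sS sx sy).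
  have -> : sgn K i S = const_frac (sgn k i S) by rewrite /sgn rmorph_sign.
  apply: subspaceZ => //; apply: (sections_restrict (subD1set S i)) => //.
  have := Cc (S :\ i); rewrite ifT //.
  by move: cS; rewrite (cardsD1 i S) iS add1n => -[->].
apply: big1 => i iS; have := Cc (S :\ i); rewrite ifF => [->|].
  by rewrite scaler0.
by apply: contraFF cS => /eqP h; rewrite (cardsD1 i S) iS h.
Qed.

(** No subset of 'I_4 has five elements. *)
Lemma cochain_top (a : 'I_n -> int) A t (c : E) : cochain a A t 4 c -> c = 0.
Proof.
move=> Cc; apply/ffunP => S; have := Cc S; rewrite ffunE ifF //.
by apply: contraTF (max_card (mem S)) => /eqP ->; rewrite card_ord.
Qed.

Lemma cochain_mono (a : 'I_n -> int) A B t p (c : E) :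
  (forall w, A w -> B w) -> cochain a A t p c -> cochain a B t p c.
Proof.
by move=> AB Cc S; have := Cc S; case: ifP => // _; apply: sections_mono.
Qed.

Lemma euler_charE (a : 'I_n -> int) A B t z :
  euler_char a A B t z <->
  chi const_frac (@cech_d k n) (cochain a A t) (cochain a B t) z.
Proof.
have qE (U V : E -> Prop) m : quotient_dim U V m <-> qdim const_frac U V m.
  by split=> -[e [Ue h]]; exists e.
have hE p m : quotient_dim (cocycle a A B t p) (coboundary a A B t p) m <->
    qdim const_frac (cocycles (@cech_d k n) (cochain a A t) (cochain a B t) p)
      (coboundaries (@cech_d k n) (cochain a A t) (cochain a B t) p) m.
  apply: (iff_trans (qE _ _ _)); apply: qdim_ext => c; first by [].
  by case: p.
split.
  by move=> [h [hh ->]]; exists h; split=> // p /hh/hE.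
by move=> [h [hh ->]]; exists h; split=> // p /hh/hE.
Qed.

Section Triple.

Variables (a : 'I_n -> int) (A0 A1 A2 : 'cV[R]_n -> Prop) (t : int).
Hypotheses (sA0 : submodule A0) (sA1 : submodule A1) (sA2 : submodule A2).
Hypotheses (A01 : forall w, A0 w -> A1 w) (A12 : forall w, A1 w -> A2 w).

Let cA0 := cochain_subcomplex a t sA0.
Let cA1 := cochain_subcomplex a t sA1.
Let cA2 := cochain_subcomplex a t sA2.
Let c01 p c := @cochain_mono a A0 A1 t p c A01.
Let c12 p c := @cochain_mono a A1 A2 t p c A12.
Let c4 c := @cochain_top a A2 t c.

Lemma euler_sub z2 z3 : euler_char a A2 A0 t z2 -> euler_char a A2 A1 t z3 ->
  euler_char a A1 A0 t (z2 - z3).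
Proof.
move=> /euler_charE h /euler_charE h'; apply/euler_charE.
exact: (chi_sub cech_differential cA0 cA1 cA2 c01 c12 c4 h h').
Qed.

Lemma euler_quot z1 z2 : euler_char a A1 A0 t z1 -> euler_char a A2 A0 t z2 ->
  euler_char a A2 A1 t (z2 - z1).
Proof.
move=> /euler_charE h /euler_charE h'; apply/euler_charE.
exact: (chi_quot cech_differential cA0 cA1 cA2 c01 c12 c4 h h').
Qed.

Lemma euler_add z1 z3 : euler_char a A1 A0 t z1 -> euler_char a A2 A1 t z3 ->
  euler_char a A2 A0 t (z1 + z3).
Proof.
move=> /euler_charE h /euler_charE h'; apply/euler_charE.
exact: (chi_add cech_differential cA0 cA1 cA2 c01 c12 c4 h h').
Qed.

End Triple.

Lemma euler_ext (a a' : 'I_n -> int) A A' B B' t t' z :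
  (forall S v, S != set0 -> sections a A t S v <-> sections a' A' t' S v) ->
  (forall S v, S != set0 -> sections a B t S v <-> sections a' B' t' S v) ->
  euler_char a A B t z <-> euler_char a' A' B' t' z.
Proof.
move=> hA hB; apply: (iff_trans (euler_charE _ _ _ _ _)).
apply: (iff_trans _ (iff_sym (euler_charE _ _ _ _ _))); apply: chi_ext => p c.
  split=> h S; have := h S; case: ifP => // /eqP cS /hA; apply;
  by rewrite -card_gt0 cS.
split=> h S; have := h S; case: ifP => // /eqP cS /hB; apply;
by rewrite -card_gt0 cS.
Qed.

End Modules.

(** * Homomorphisms of graded modules *)

Definition hproj (z : int) (p : R) : R :=
  if z is Posz d then pihomog mdeg d p else 0.

Definition gproj n (a : 'I_n -> int) (z : int) (w : 'cV[R]_n) : 'cV[R]_n :=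
  \col_j hproj (z + a j) (w j ord0).

Lemma hprojD z p q : hproj z (p + q) = hproj z p + hproj z q.
Proof. by case: z => d /=; rewrite ?raddfD ?addr0. Qed.

Lemma homogz_hproj z p : homogz z (hproj z p).
Proof. by case: z => d //=; apply: pihomogP. Qed.

Lemma hproj_id z p : homogz z p -> hproj z p = p.
Proof. by case: z => d //= hp; apply: pihomog_dE. Qed.

Lemma hproj_neq0 z z' p : z != z' -> homogz z' p -> hproj z p = 0.
Proof.
case: z z' => [d|d] [d'|d'] //= ne; last by move=> ->; rewrite raddf0.
by apply: pihomog_ne0; rewrite eq_sym.
Qed.

Lemma hproj_sum (c M : nat) (p : R) : (c + msize p <= M)%N ->
  p = \sum_(0 <= i < M) hproj (i%:Z - c%:Z) p.
Proof.
move=> cM; rewrite (big_cat_nat (n := c)) //=; last by lia.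
rewrite [X in X + _]big_nat_cond [X in X + _]big1 ?add0r; last first.
  move=> i; rewrite andbT => /andP[_ ic].
  by rewrite (_ : i%:Z - c%:Z = Negz (c - i).-1) //; lia.
rewrite -{1}[c]add0n big_addn.
rewrite (eq_bigr (fun d => pihomog mdeg d p)); last first.
  by move=> i _; rewrite PoszD addrK.
rewrite big_mkord; apply: pihomog_partitionE; lia.
Qed.

Section Projections.

Variables (n : nat) (a : 'I_n -> int).
Implicit Types (u v w : 'cV[R]_n).

Lemma gprojD z u v : gproj a z (u + v) = gproj a z u + gproj a z v.
Proof. by apply/colP => j; rewrite !mxE hprojD. Qed.

Lemma gproj0 z : gproj a z 0 = 0.
Proof. by apply: (addrI (gproj a z 0)); rewrite -gprojD !addr0. Qed.

Lemma gproj_graded z w : graded_piece a z (gproj a z w).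
Proof. by move=> j; rewrite mxE; apply: homogz_hproj. Qed.

Lemma gproj_id z w : graded_piece a z w -> gproj a z w = w.
Proof. by move=> gw; apply/colP => j; rewrite mxE hproj_id. Qed.

Lemma gproj_neq0 z z' w : z != z' -> graded_piece a z' w -> gproj a z w = 0.
Proof.
move=> ne gw; apply/colP => j; rewrite !mxE; apply: (hproj_neq0 _ (gw j)).
by rewrite (inj_eq (addIr _)).
Qed.

(** In coordinate j the components of degree below - a j vanish, and so do
    those beyond the degree of w j: finitely many components are left, uniformly
    in j. *)
Lemma gproj_sum w :
  exists (M N : nat), w = \sum_(i < M) gproj a (i%:Z - N%:Z) w.
Proof.
pose N := (\sum_j `|a j|)%N; pose M := (N + N + \sum_j msize (w j ord0))%N.
have aN j : (`|a j| <= N)%N by rewrite /N (bigD1 j) //= leq_addr.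
have wM j : (msize (w j ord0) + N + N <= M)%N.
  by rewrite /M (bigD1 j) //=; lia.
exists M, N; apply/colP => j; rewrite summxE.
rewrite {1}(@hproj_sum (absz (N%:Z - a j)) M (w j ord0)); last first.
  by have := aN j; have := wM j; lia.
rewrite big_mkord; apply: eq_bigr => i _; rewrite mxE; congr (hproj _ _).
by have := aN j; lia.
Qed.

End Projections.

Section Morphism.

Variables (n1 n2 : nat) (a1 : 'I_n1 -> int) (a2 : 'I_n2 -> int).
Variables (A : 'cV[R]_n1 -> Prop) (phi : 'cV[R]_n1 -> 'cV[R]_n2).
Hypothesis sA : submodule A.
Hypothesis A_gproj : forall z v, A v -> A (gproj a1 z v).
Hypothesis phi_lin : forall (r : R) u v, A u -> A v ->
  phi (r *: u + v) = r *: phi u + phi v.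
Hypothesis phi_graded : forall z v, A v -> graded_piece a1 z v ->
  graded_piece a2 z (phi v).

Definition hom_kernel v : Prop := A v /\ phi v = 0.
Definition hom_image w : Prop := exists v, A v /\ w = phi v.

Lemma homD u v : A u -> A v -> phi (u + v) = phi u + phi v.
Proof. by move=> Au Av; rewrite -[u]scale1r phi_lin // !scale1r. Qed.

Lemma hom0 : phi 0 = 0.
Proof.
have A0 : A 0 by case: sA.
by apply: (addrI (phi 0)); rewrite -homD // !addr0.
Qed.

Lemma homZ r u : A u -> phi (r *: u) = r *: phi u.
Proof.
have A0 : A 0 by case: sA.
by move=> Au; rewrite -[r *: u]addr0 phi_lin // hom0 addr0.
Qed.

Lemma hom_sum (J : finType) (u : J -> 'cV[R]_n1) : (forall j, A (u j)) ->
  phi (\sum_j u j) = \sum_j phi (u j).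
Proof.
move=> Au; suff [] : A (\sum_j u j) /\ phi (\sum_j u j) = \sum_j phi (u j) by [].
elim/big_rec2: _ => [|j y x _ [Ax <-]]; first by split; [case: sA | apply: hom0].
by split; [apply: submodD | rewrite homD].
Qed.

Lemma hom_kernel_submodule : submodule hom_kernel.
Proof.
split; first by split; [case: sA | apply: hom0].
move=> r u v [Au pu] [Av pv]; split; first by case: sA => _; apply.
by rewrite phi_lin // pu pv scaler0 addr0.
Qed.

Lemma hom_image_submodule : submodule hom_image.
Proof.
split; first by exists 0; rewrite hom0; case: sA.
move=> r _ _ [u [Au ->]] [v [Av ->]]; exists (r *: u + v); split.
  by case: sA => _; apply.
by rewrite phi_lin.
Qed.

(** On each homogeneous component of v both sides vanish unless its degree
    is z. *)
Lemma hom_gproj z v : A v -> phi (gproj a1 z v) = gproj a2 z (phi v).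
Proof.
move=> Av; have [M [N vE]] := gproj_sum a1 v.
pose u (i : 'I_M) := gproj a1 (i%:Z - N%:Z) v.
have Au i : A (u i) by apply: A_gproj.
have gsum n a (J : finType) (w : J -> 'cV[R]_n) :
    gproj a z (\sum_j w j) = \sum_j gproj a z (w j).
  by apply: (big_morph (gproj a z)); [apply: gprojD | apply: gproj0].
rewrite (vE : v = \sum_i u i) gsum !hom_sum // ?gsum; last first.
  by move=> j; apply: A_gproj.
apply: eq_bigr => i _; have gu : graded_piece a1 (i%:Z - N%:Z) (u i).
  exact: gproj_graded.
have [->|ne] := eqVneq z (i%:Z - N%:Z).
  by rewrite !gproj_id //; apply: phi_graded.
by rewrite (gproj_neq0 ne gu) hom0 (gproj_neq0 ne (phi_graded (Au i) gu)).
Qed.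

Lemma hom_kernel_gproj z v : hom_kernel v -> hom_kernel (gproj a1 z v).
Proof. by case=> Av pv; split; [apply: A_gproj | rewrite hom_gproj // pv gproj0]. Qed.

(** A homogeneous element of the image is the image of a homogeneous element,
    namely of a graded component of any preimage. *)
Lemma hom_image_graded z w : hom_image w -> graded_piece a2 z w ->
  exists v, [/\ A v, graded_piece a1 z v & w = phi v].
Proof.
case=> v [Av ->] gv; exists (gproj a1 z v).
by rewrite hom_gproj // (gproj_id gv); split=> //; [apply: A_gproj|apply: gproj_graded].
Qed.

(** The extension of phi to fractions, v = w / s being related to phi w / s. *)
Definition frac_graph (v : 'cV[K]_n1) (r : 'cV[K]_n2) : Prop :=
  exists (s : R) w, [/\ s != 0, A w, map_mx tf w = tf s *: v
    & map_mx tf (phi w) = tf s *: r].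

Lemma frac_graph0 : frac_graph 0 0.
Proof.
exists 1, 0; rewrite oner_neq0 hom0; split=> //; first by case: sA.
  by rewrite raddf0 scaler0.
by rewrite raddf0 scaler0.
Qed.

Lemma frac_graphP r u1 u2 v1 v2 : frac_graph u1 u2 -> frac_graph v1 v2 ->
  frac_graph (tf r *: u1 + v1) (tf r *: u2 + v2).
Proof.
case=> [s [w [s0 Aw w1 w2]]] [s' [w' [s'0 Aw' w'1 w'2]]].
exists (s * s'), ((r * s') *: w + s *: w'); split.
- by rewrite mulf_neq0.
- by case: (sA) => _; apply=> //; apply: submodZ.
- rewrite map_tfD !map_tfZ w1 w'1 !scalerDr !scalerA !rmorphM.
  by congr (_ *: _ + _ *: _); ring.
- rewrite phi_lin ?homZ //; last exact: submodZ.
  rewrite map_tfD !map_tfZ w2 w'2 !scalerDr !scalerA !rmorphM.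
  by congr (_ *: _ + _ *: _); ring.
Qed.

Lemma map_tf0 n : map_mx tf (0 : 'cV[R]_n) = 0.
Proof. exact: raddf0. Qed.

Lemma sections_zero n (a : 'I_n -> int) t S (v : 'cV[K]_n) :
  sections a (fun w => w = 0) t S v <-> v = 0.
Proof.
split=> [[N [_ [-> _]]]|->].
  rewrite map_tf0 => /esym/eqP; rewrite scalemx_eq0.
  by rewrite (negbTE (tf_x_prod_neq0 _ _)) => /eqP.
exists 0%N, 0; rewrite map_tf0 scaler0; split=> // j.
by rewrite mxE; apply: homogz0.
Qed.

Lemma frac_graph_total t S v : sections a1 A t S v ->
  exists2 r, sections a2 hom_image t S r & frac_graph v r.
Proof.
case=> N [w [Aw gw wE]]; pose x := x_prod k S ^+ N.
have x0 : tf x != 0 by apply: tf_x_prod_neq0.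
exists ((tf x)^-1 *: map_mx tf (phi w)).
  exists N, (phi w); split; [by exists w | exact: phi_graded | ].
  by rewrite scalerA divff ?scale1r.
exists x, w; split=> //; first exact: x_prod_neq0.
by rewrite scalerA divff ?scale1r.
Qed.

Lemma frac_graph_surj t S r : sections a2 hom_image t S r ->
  exists2 v, sections a1 A t S v & frac_graph v r.
Proof.
case=> N [w [/hom_image_graded iw /iw[v [Av gv wE]]]]; rewrite wE => rE.
pose x := x_prod k S ^+ N; have x0 : tf x != 0 by apply: tf_x_prod_neq0.
exists ((tf x)^-1 *: map_mx tf v).
  by exists N, v; split=> //; rewrite scalerA divff ?scale1r.
exists x, v; split=> //; first exact: x_prod_neq0.
by rewrite scalerA divff ?scale1r.
Qed.

(** Two numerators of v become equal after multiplication by the denominators,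
    and R has no zero divisors, so phi kills both or none. *)
Lemma frac_graph_kernel t S v r : sections a1 A t S v -> frac_graph v r ->
  sections a1 hom_kernel t S v <-> r = 0.
Proof.
move=> Sv [s [w [s0 Aw wv wr]]].
have compare N w1 : A w1 -> map_mx tf w1 = tf (x_prod k S ^+ N) *: v ->
    x_prod k S ^+ N *: phi w = s *: phi w1.
  move=> Aw1 w1E; rewrite -!homZ //; congr phi; apply: map_tf_inj.
  by rewrite !map_tfZ wv w1E !scalerA mulrC.
split=> [[N [w1 [[Aw1 pw1] _ w1E]]]|r0].
  have /eqP := compare N w1 Aw1 w1E; rewrite pw1 scaler0 scalemx_eq0.
  rewrite (negbTE (x_prod_neq0 _ _)) => /eqP pw0; move/esym/eqP: wr.
  by rewrite pw0 raddf0 scalemx_eq0 tofrac_eq0 (negbTE s0) => /eqP.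
case: Sv => N [w1 [Aw1 gw1 w1E]]; exists N, w1; split=> //; split=> //.
have /esym/eqP := compare N w1 Aw1 w1E.
have -> : phi w = 0 by apply: map_tf_inj; rewrite wr r0 scaler0 raddf0.
by rewrite scaler0 scalemx_eq0 (negbTE s0) => /eqP.
Qed.

Lemma zero_submodule n : submodule (fun w : 'cV[R]_n => w = 0).
Proof. by split=> // r u v -> ->; rewrite scaler0 addr0. Qed.

(** The sheaf associated with A modulo the kernel of phi is isomorphic to the
    one associated with the image, since localization is exact. *)
Theorem euler_morphism t z :
  euler_char a1 A hom_kernel t z <-> euler_char a2 hom_image (fun w => w = 0) t z.
Proof.
apply: (iff_trans (euler_charE _ _ _ _ _)).
apply: (iff_trans _ (iff_sym (euler_charE _ _ _ _ _))).
pose G (c1 : {ffun {set 'I_4} -> 'cV[K]_n1}) (c2 : {ffun {set 'I_4} -> 'cV[K]_n2}) :=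
  forall S, frac_graph (c1 S) (c2 S).
apply: (chi_iso (G := G)).
- exact: cech_differential.
- exact: cech_differential.
- exact: cochain_subcomplex.
- exact/cochain_subcomplex/hom_kernel_submodule.
- exact/cochain_subcomplex/hom_image_submodule.
- exact/cochain_subcomplex/zero_submodule.
- split=> [S|c u1 v1 u2 v2 Gu Gv S]; rewrite !ffunE; first exact: frac_graph0.
  exact: frac_graphP.
- move=> c c' Gc S; rewrite !cech_dE.
  elim/big_rec2: _ => [|i x y iS]; first exact: frac_graph0.
  have -> : sgn K i S = tf (sgn R i S) by rewrite /sgn rmorph_sign.
  by apply: frac_graphP; apply: Gc.
- move=> p c Cc.
  have /fin_all_exists2[c' Cc' Gc'] : forall S : {set 'I_4}, exists2 r,
      (if #|S| == p.+1 then sections a2 hom_image t S r else r = 0) & frac_graph (c S) r.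
    move=> S; have := Cc S; case: ifP => _; first exact: frac_graph_total.
    by move=> ->; exists 0 => //; apply: frac_graph0.
  by exists (finfun c') => S; rewrite ffunE; [apply: Cc' | apply: Gc'].
- move=> p c Cc.
  have /fin_all_exists2[c' Cc' Gc'] : forall S : {set 'I_4}, exists2 v,
      (if #|S| == p.+1 then sections a1 A t S v else v = 0) & frac_graph v (c S).
    move=> S; have := Cc S; case: ifP => _; first exact: frac_graph_surj.
    by move=> ->; exists 0 => //; apply: frac_graph0.
  by exists (finfun c') => S; rewrite ffunE; [apply: Cc' | apply: Gc'].
move=> p c c' Cc Cc' Gc.
split=> h S; have := h S; have := Cc S; have := Cc' S; case: ifP => // _ _ Sc.
  by move/(frac_graph_kernel Sc (Gc S)) => ->; apply/sections_zero.
by move/sections_zero => c0; apply/(frac_graph_kernel Sc (Gc S)).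
Qed.

End Morphism.

(** * Cohomology of the structure sheaf *)

Section StructureSheaf.

Implicit Types (S : {set 'I_4}).

Lemma homogzP z (p : R) :
  homogz z p <-> forall m, p@_m != 0 -> (mdeg m)%:Z = z.
Proof.
case: z => d /=; split.
- by move=> hp m; rewrite -mcoeff_msupp => /(dhomog_mf hp) ->.
- by move=> hp; apply/dhomogP => m; rewrite mcoeff_msupp => /hp [].
- by move=> -> m; rewrite mcoeff0 eqxx.
by move=> hp; apply/mpolyP => m; rewrite mcoeff0; apply/eqP; apply: contraT => /hp.
Qed.

Definition mfilter (P : pred 'X_{1..4}) (p : R) : R :=
  \sum_(m <- msupp p | P m) p@_m *: 'X_[m].

Lemma coeff_sum_monomials (c : 'X_{1..4} -> k) (s : seq 'X_{1..4}) m : uniq s ->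
  (\sum_(x <- s) c x *: 'X_[x] : R)@_m = if m \in s then c m else 0.
Proof.
move=> us; rewrite raddf_sum /=; under eq_bigr do rewrite mcoeffZ mcoeffX.
case: ifP => ms; last first.
  rewrite big_seq big1 // => x xs; case: eqP => [xm|_]; last by rewrite mulr0.
  by rewrite -xm xs in ms.
rewrite (bigD1_seq m) //= eqxx mulr1 big1 ?addr0 // => x /negbTE ->.
by rewrite mulr0.
Qed.

Lemma coeff_mfilter P (p : R) m : (mfilter P p)@_m = if P m then p@_m else 0.
Proof.
rewrite /mfilter -big_filter coeff_sum_monomials ?filter_uniq ?msupp_uniq //.
rewrite mem_filter; case: (P m) => //=; case: ifP => // /negbT.
by move/memN_msupp_eq0.
Qed.

Definition mnm_on (N : nat) (S : {set 'I_4}) : 'X_{1..4} :=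
  [multinom (if i \in S then N else 0)%N | i < 4].

Lemma x_prod_monomial S N : x_prod k S ^+ N = 'X_[mnm_on N S].
Proof.
rewrite /x_prod mprodXE mpolyXn; congr mpolyX; apply/mnmP => i.
rewrite mulmnE mnm_sumE mnmE; case: ifP => iS.
  rewrite (bigD1 i) //= mnm1E eqxx big1 ?addn0 ?mul1n // => j /andP[_ ji].
  by rewrite mnm1E (negbTE ji).
rewrite big1 // => j jS; rewrite mnm1E; case: eqP => // ji.
by rewrite -ji jS in iS.
Qed.

Lemma mdeg_mnm_on S N : mdeg (mnm_on N S) = (N * #|S|)%N.
Proof.
rewrite mdegE (eq_bigr (fun i => if i \in S then N else 0%N)).
  by rewrite -big_mkcond sum_nat_const mulnC.
by move=> i _; rewrite mnmE.
Qed.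

Lemma coeff_mulX_neq0 (p : R) u m : (p * 'X_[u])@_m != 0 ->
  exists2 m', p@_m' != 0 & m = (m' + u)%MM.
Proof.
rewrite -mcoeff_msupp (perm_mem (msuppMX _ _)) => /mapP[m' m'p ->].
by exists m'; rewrite -?mcoeff_msupp // addmC.
Qed.

Lemma monomial_divides (p : R) u :
  (forall m, p@_m != 0 -> (u <= m)%MM) -> exists q : R, p = q * 'X_[u].
Proof.
move=> hp; exists (\sum_(m <- msupp p) p@_m *: 'X_[m - u]).
rewrite mulr_suml {1}[p]mpolyE big_seq [RHS]big_seq; apply: eq_bigr => m mp.
by rewrite -scalerAl -mpolyXD submK // hp // -mcoeff_msupp.
Qed.

(** The polynomials p such that p / (x_0 x_1 x_2 x_3)^N is a section of O(t)
    over D(x_S): poles are allowed along x_i for i in S only. *)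
Definition laurent_numerator (N : nat) (t : int) (S : {set 'I_4}) (p : R) : Prop :=
  forall m, p@_m != 0 ->
    (mdeg m)%:Z = (N * 4)%N%:Z + t /\ forall i, i \notin S -> (N <= m i)%N.

Lemma mdeg_mnm_on_setT N : mdeg (mnm_on N setT) = (N * 4)%N.
Proof. by rewrite mdeg_mnm_on cardsT card_ord. Qed.

Lemma laurent_raise M N t S p : laurent_numerator N t S p ->
  laurent_numerator (M + N) t S (p * x_prod k setT ^+ M).
Proof.
rewrite x_prod_monomial => hp _ /coeff_mulX_neq0[m /hp[dm hm] ->].
rewrite mdegD mdeg_mnm_on_setT; split; first by lia.
by move=> i /hm; rewrite mnmDE mnmE inE; lia.
Qed.

Lemma mul_cardsC N (S : {set 'I_4}) : (N * 4 = N * #|S| + N * #|~: S|)%N.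
Proof. by rewrite -mulnDr cardsC card_ord. Qed.

Lemma laurent_divide N t S p : laurent_numerator N t S p ->
  exists q : R, p = q * x_prod k (~: S) ^+ N /\ homogz ((N * #|S|)%N%:Z + t) q.
Proof.
rewrite x_prod_monomial => hp.
have [|q pE] := @monomial_divides p (mnm_on N (~: S)).
  move=> m /hp[_ hm]; apply/mnm_lepP => i; rewrite mnmE inE.
  by case: ifP => // /hm.
exists q; split=> //; apply/homogzP => m qm.
have [|dm _] := hp (m + mnm_on N (~: S))%MM.
  by rewrite pE addmC mcoeffMX.
by move: dm (mul_cardsC N S); rewrite mdegD mdeg_mnm_on; lia.
Qed.

Local Notation a0 := (fun _ : 'I_1 => 0 : int).
Local Notation full := (fun _ : 'cV[R]_1 => True).
Local Notation zero := (fun w : 'cV[R]_1 => w = 0).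
Local Notation E := {ffun {set 'I_4} -> 'cV[K]_1}.

Lemma x_prodC S N : x_prod k setT ^+ N = x_prod k S ^+ N * x_prod k (~: S) ^+ N.
Proof.
rewrite -exprMn /x_prod -bigU /=; last by rewrite -setI_eq0 setICr.
by congr (_ ^+ _); apply: eq_bigl => i; rewrite !inE; case: (i \in S).
Qed.

Lemma sections_laurent t S (v : 'cV[K]_1) : sections a0 full t S v <->
  exists N p, laurent_numerator N t S p /\ tf p = tf (x_prod k setT ^+ N) * v ord0 ord0.
Proof.
split=> [[N [w [_ gw wE]]]|[N [p [hp pE]]]].
  exists N, (w ord0 ord0 * x_prod k (~: S) ^+ N); split.
    rewrite x_prod_monomial => _ /coeff_mulX_neq0[m wm ->].
    have /homogzP/(_ m wm) := gw ord0; rewrite addr0 mdegD mdeg_mnm_on => dm.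
    split; first by move: dm (mul_cardsC N S); lia.
    by move=> i iS; rewrite mnmDE mnmE inE iS leq_addl.
  have /matrixP/(_ ord0 ord0) := wE; rewrite !mxE => wE0.
  by rewrite tofracM wE0 (x_prodC S) tofracM mulrAC.
have [q [pq hq]] := laurent_divide hp.
exists N, (const_mx q); split=> //.
  by move=> j; rewrite mxE addr0.
apply/matrixP => i j; rewrite !ord1 !mxE.
apply: (mulIf (tf_x_prod_neq0 (~: S) N)).
by rewrite -tofracM -pq pE (x_prodC S) tofracM mulrAC.
Qed.

(** There are finitely many open sets, so the components of a cochain have a
    common denominator, with as large an exponent as desired. *)
Lemma cochain_numerators N0 t p (c : E) : cochain a0 full t p c ->
  exists (N : nat) (w : {set 'I_4} -> R), [/\ (N0 <= N)%N,
    forall S, tf (w S) = tf (x_prod k setT ^+ N) * c S ord0 ord0,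
    forall S, #|S| = p.+1 -> laurent_numerator N t S (w S)
    & forall S, #|S| != p.+1 -> w S = 0].
Proof.
move=> Cc.
have /fin_all_exists2[n _ /fin_all_exists[w hw]] : forall S : {set 'I_4},
    exists2 N : nat, True & exists q, 
      (if #|S| == p.+1 then laurent_numerator N t S q else q = 0) /\
      tf q = tf (x_prod k setT ^+ N) * c S ord0 ord0.
  move=> S; have := Cc S; case: ifP => _.
    by case/sections_laurent => N [q hq]; exists N => //; exists q.
  by move=> ->; exists 0%N => //; exists 0; rewrite mxE mulr0 rmorph0.
pose N := (N0 + \sum_S n S)%N.
have nN S : (n S <= N)%N by rewrite /N (bigD1 S) //=; lia.
exists N, (fun S => w S * x_prod k setT ^+ (N - n S)); split=> [|S|S cS|S cS].
- by rewrite leq_addr.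
- have [_ wS] := hw S; rewrite tofracM wS mulrAC -tofracM -exprD.
  by rewrite subnKC.
- have [wS _] := hw S; rewrite cS eqxx in wS.
  by rewrite -{1}(subnK (nN S)); apply: laurent_raise.
- by have [wS _] := hw S; rewrite (negbTE cS) in wS; rewrite wS mul0r.
Qed.

(** For a fixed Laurent monomial, the coefficients of a cochain form a function
    on the subsets of 'I_4, and the Cech differential becomes the simplicial
    coboundary, empty simplex included.  It is contracted by coning off from
    the vertex i0. *)
Section Homotopy.

Variable i0 : 'I_4.
Implicit Types (u : {set 'I_4} -> k).

Definition simplex_d u S : k := \sum_(i in S) sgn k i S * u (S :\ i).
Definition simplex_h u S : k := if i0 \in S then 0 else sgn k i0 S * u (i0 |: S).

Lemma simplex_homotopy u S :
  simplex_d (simplex_h u) S + simplex_h (simplex_d u) S = u S.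
Proof.
rewrite /simplex_d /simplex_h; case: ifP => i0S.
  rewrite addr0 (bigD1 i0) //= !inE eqxx /= setD1K // sgn_self mulrA sgn_sq mul1r.
  rewrite big1 ?addr0 // => i /andP[iS ii0].
  by rewrite !inE eq_sym ii0 i0S /= mulr0.
have i0S' : i0 \notin S by rewrite i0S.
rewrite big_setU1 //= setU1K // mulrDr mulrA.
have -> : sgn k i0 (i0 |: S) = sgn k i0 S by rewrite sgn_add // ltnn.
rewrite sgn_sq mul1r addrC -addrA mulr_sumr -big_split big1 ?addr0 //= => i iS.
have ii0 : i != i0 by apply: contraTneq iS => ->.
rewrite !inE eq_sym (negbTE ii0) /= i0S.
have -> : (i0 |: S) :\ i = i0 |: (S :\ i).
  by apply/setP => x; rewrite !inE; case: (x =P i) => [->|_]; rewrite ?(negbTE ii0).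
rewrite !mulrA -mulrDl sgn_rem // sgn_add //.
have [h|h|/val_inj h] := ltngtP i i0.
- by rewrite (_ : _ + _ = 0) ?mul0r //; ring.
- by rewrite (_ : _ + _ = 0) ?mul0r //; ring.
- by rewrite h eqxx in ii0.
Qed.

End Homotopy.

Definition poly_d (w : {set 'I_4} -> R) S : R :=
  \sum_(i in S) sgn R i S * w (S :\ i).

(** A variable along which the Laurent monomial m / (x_0 x_1 x_2 x_3)^N has no
    pole, if any; the choice only depends on the monomial. *)
Definition free_index N (m : 'X_{1..4}) : option 'I_4 := [pick i | N <= m i]%N.

(** On each monomial, the cone construction from the vertex chosen for it. *)
Definition poly_h N (w : {set 'I_4} -> R) S : R :=
  \sum_(i in ~: S)
    sgn R i S * mfilter (fun m => free_index N m == Some i) (w (i |: S)).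

Definition polar_part N : R -> R := mfilter (fun m => free_index N m == None).

Lemma coeff_sgn i S (p : R) m : (sgn R i S * p)@_m = sgn k i S * p@_m.
Proof.
rewrite /sgn -signr_odd -[in RHS]signr_odd !mulr_sign.
by case: odd; rewrite ?mcoeffN.
Qed.

Lemma coeff_poly_d w S m : (poly_d w S)@_m = simplex_d (fun S => (w S)@_m) S.
Proof. by rewrite raddf_sum /=; apply: eq_bigr => i _; rewrite coeff_sgn. Qed.

Lemma coeff_poly_h N w S m : (poly_h N w S)@_m =
  if free_index N m is Some i then simplex_h i (fun S => (w S)@_m) S else 0.
Proof.
rewrite raddf_sum /=.
under eq_bigr do rewrite coeff_sgn coeff_mfilter.
case: free_index => [j|]; last by rewrite big1 // => i _; rewrite mulr0.
rewrite /simplex_h; case: ifP => jS.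
  rewrite big1 // => i; rewrite inE; case: eqP => [[<-]|_ _]; last by rewrite mulr0.
  by rewrite jS.
rewrite (bigD1 j) ?inE ?jS //= eqxx big1 ?addr0 // => i /andP[_ ij].
by rewrite (inj_eq Some_inj) eq_sym (negbTE ij) mulr0.
Qed.

Lemma poly_homotopy N w S :
  w S = poly_d (poly_h N w) S + poly_h N (poly_d w) S + polar_part N (w S).
Proof.
apply/mpolyP => m; rewrite !mcoeffD coeff_poly_d coeff_poly_h coeff_mfilter.
have ext u u' : u =1 u' -> simplex_d u S = simplex_d u' S.
  by move=> uu; apply: eq_bigr => i _; rewrite uu.
rewrite (ext _ _ (fun S => coeff_poly_h N w S m)).
case: (free_index N m) => [i|] /=; last first.
  by rewrite /simplex_d big1 ?add0r // => i _; rewrite mulr0.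
rewrite addr0 -[LHS](simplex_homotopy i (fun S => (w S)@_m)); congr (_ + _).
by rewrite /simplex_h; case: ifP => // _; rewrite coeff_poly_d.
Qed.

Lemma free_indexP N m i : free_index N m = Some i -> (N <= m i)%N.
Proof. by rewrite /free_index; case: pickP => // j hj [<-]. Qed.

Lemma free_index_none N m : free_index N m = None -> forall i, (m i < N)%N.
Proof. by rewrite /free_index; case: pickP => // h _ i; rewrite ltnNge h. Qed.

(** A section over D(x_S) has no pole along x_i for i outside S. *)
Lemma polar_part0 N t S p : S != setT -> laurent_numerator N t S p -> polar_part N p = 0.
Proof.
move=> /eqP ST hp; apply/mpolyP => m; rewrite coeff_mfilter mcoeff0.
case: eqP => // /free_index_none hm; apply/eqP; apply: contraT => /hp[_ hN].
case: ST; apply/setP => i; rewrite inE; apply: contraT => /hN.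
by rewrite leqNgt hm.
Qed.

(** The cone from i uses the values over D(x_S) n D(x_i) only on monomials
    without pole along x_i, so the result is a section over D(x_S). *)
Lemma laurent_poly_h N t w S :
  (forall i, i \notin S -> laurent_numerator N t (i |: S) (w (i |: S))) ->
  laurent_numerator N t S (poly_h N w S).
Proof.
move=> hw m; rewrite coeff_poly_h; case E: free_index => [i|]; last by rewrite eqxx.
rewrite /simplex_h; case: ifP => iS; first by rewrite eqxx.
move=> nz; have wm : (w (i |: S))@_m != 0.
  by apply: contraNneq nz => ->; rewrite mulr0.
have [dm hm] := hw i (negbT iS) m wm; split=> // j jS.
have [->|ji] := eqVneq j i; first exact: free_indexP.
by apply: hm; rewrite !inE negb_or ji.
Qed.

Local Notation D := (@cech_d k 1).

Lemma cochain_zero t p (c : E) : cochain a0 zero t p c <-> c = 0.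
Proof.
split=> [Cc|-> S]; last by rewrite ffunE; case: ifP => // _; apply/sections_zero.
apply/ffunP => S; rewrite [RHS]ffunE; have := Cc S; case: ifP => // _.
by move/sections_zero.
Qed.

Lemma full_submodule : submodule full. Proof. by []. Qed.

Lemma const_fracM (c : k) (p : R) : const_frac c * tf p = tf (c *: p).
Proof. by rewrite -mul_mpolyC tofracM. Qed.

Definition laurent_cochain N (h : {set 'I_4} -> R) : E :=
  [ffun S => const_mx ((tf (x_prod k setT ^+ N))^-1 * tf (h S))].

Lemma cech_d_numerator y (w : {set 'I_4} -> R) (c : E) :
  (forall S, tf (w S) = tf y * c S ord0 ord0) ->
  forall S, tf (poly_d w S) = tf y * D c S ord0 ord0.
Proof.
move=> wc S; rewrite cech_dE summxE mulr_sumr rmorph_sum /=; apply: eq_bigr => i _.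
rewrite mxE tofracM wc mulrCA; congr (_ * _).
by rewrite /sgn rmorph_sign.
Qed.

(** The homotopy formula for a cocycle.  The polar part is present in top degree
    only; for p = 0 the primitive lives on the empty set, where it is a global
    section. *)
Lemma cocycle_decomposition N0 t p (c : E) : cochain a0 full t p c -> D c = 0 ->
  exists N w h, [/\ (N0 <= N)%N,
    (forall S, #|S| = p -> laurent_numerator N t S (h S)) /\
      (forall S, #|S| != p -> h S = 0),
    forall S, #|S| = p.+1 -> laurent_numerator N t S (w S),
    forall S, #|S| != p.+1 -> w S = 0
    & c = D (laurent_cochain N h) + laurent_cochain N (fun S => polar_part N (w S))].
Proof.
move=> Cc Dc; have [N [w [N0N wc wl w0]]] := cochain_numerators N0 Cc.
exists N, w, (poly_h N w); split=> //.
  split=> S cS.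
    apply: laurent_poly_h => i iS; apply: wl.
    by rewrite cardsU1 iS cS.
  rewrite /poly_h big1 // => i; rewrite inE => iS.
  rewrite w0; last by rewrite cardsU1 iS add1n eqSS.
  by rewrite /mfilter msupp0 big_nil mulr0.
have dw S : poly_d w S = 0.
  by apply/eqP; rewrite -tofrac_eq0 (cech_d_numerator wc) Dc ffunE mxE mulr0.
have hdw S : poly_h N (poly_d w) S = 0.
  rewrite /poly_h big1 // => i _; rewrite dw /mfilter msupp0 big_nil mulr0 //.
have x0 := tf_x_prod_neq0 setT N.
apply/ffunP => S; apply/matrixP => i j; rewrite !ord1 {i j}.
rewrite ffunE mxE; apply: (mulfI x0); rewrite mulrDr.
rewrite -(cech_d_numerator (w := poly_h N w)); last first.
  by move=> S'; rewrite ffunE mxE mulVKf.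
by rewrite ffunE mxE mulVKf // -tofracD -wc {1}[w S](poly_homotopy N) hdw addr0.
Qed.

Definition monomials (z : int) : seq 'X_{1..4} :=
  if z is Posz d then [seq s2m (val s) | s <- enum (basis 4 d)] else [::].

Lemma mem_monomials z m : (m \in monomials z) = ((mdeg m)%:Z == z).
Proof. by case: z => d //=; rewrite eqz_nat -basis_cover. Qed.

Lemma uniq_monomials z : uniq (monomials z).
Proof. by case: z => d //=; apply: uniq_basis. Qed.

Lemma size_monomials d : size (monomials d%:Z) = 'C(d + 3, 3).
Proof. by rewrite /= mpoly.size_basis -bin_sub ?leq_addr // addKn. Qed.

Lemma coeff_indexed (s : seq 'X_{1..4}) (c : 'I_(size s) -> k)
    (j : 'I_(size s)) : uniq s ->
  (\sum_i c i *: 'X_[nth 0%MM s i] : R)@_(nth 0%MM s j) = c j.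
Proof.
move=> us; rewrite raddf_sum /= (bigD1 j) //= mcoeffZ mcoeffX eqxx mulr1.
rewrite big1 ?addr0 // => i ij; rewrite mcoeffZ mcoeffX nth_uniq //.
by rewrite (inj_eq val_inj) (negbTE ij) mulr0.
Qed.

Lemma poly_indexed (s : seq 'X_{1..4}) (p : R) : uniq s ->
  (forall m, p@_m != 0 -> m \in s) ->
  p = \sum_(j < size s) p@_(nth 0%MM s j) *: 'X_[nth 0%MM s j].
Proof.
move=> us ps.
transitivity (\sum_(m <- s) p@_m *: 'X_[m] : R).
  apply/mpolyP => m; rewrite (coeff_sum_monomials (fun x => p@_x)) //.
  by case: ifP => // /negbT; apply: contraNeq => /ps.
by rewrite (big_nth 0%MM) big_mkord.
Qed.

Lemma cech_d_sum (J : finType) (c : J -> k) (u : J -> E) :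
  D (\sum_j const_frac (c j) *: u j) = \sum_j const_frac (c j) *: D (u j).
Proof.
have dD := cech_differential 1.
elim/big_rec2: _ => [|j x y _ <-]; first exact: (diff0 dD).
by rewrite (diffD dD) (diffZ dD).
Qed.

Section DegreeZero.

Variable t : int.

(** The polynomial r as a cochain in degree -1; its differential is the family
    of the restrictions of r to the four open sets. *)
Definition empty_cochain (r : R) : E :=
  [ffun S : {set 'I_4} => if S == set0 then const_mx (tf r) else 0].

Lemma empty_cochain_sum (J : finType) (c : J -> k) (r : J -> R) :
  \sum_j const_frac (c j) *: empty_cochain (r j) = empty_cochain (\sum_j c j *: r j).
Proof.
apply/ffunP => S; apply/matrixP => x y; rewrite sum_ffunE !ffunE summxE.
case: ifP => S0; rewrite mxE.
  rewrite rmorph_sum /=; apply: eq_bigr => j _.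
  by rewrite ffunE mxE ffunE S0 mxE const_fracM.
by rewrite big1 // => j _; rewrite ffunE mxE ffunE S0 mxE mulr0.
Qed.

Lemma cocycle_empty_cochain r : homogz t r ->
  cocycles D (cochain a0 full t) (cochain a0 zero t) 0 (D (empty_cochain r)).
Proof.
have dD := cech_differential 1.
move=> hr; split; last by apply/cochain_zero; apply: diffK dD _.
have sS S := sections_subspace a0 t S full_submodule.
move=> S; rewrite cech_dE; case: ifP => cS.
  elim/big_ind: _ => [|x y sx sy|i iS]; first by case: (sS S).
    exact: (subspaceD (sS S) sx sy).
  have -> : sgn K i S = const_frac (sgn k i S) by rewrite /sgn rmorph_sign.
  apply: (subspaceZ _ (sS S)); rewrite ffunE; case: ifP => _; last by case: (sS S).
  exists 0%N, (const_mx r); split=> //.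
    by move=> j; rewrite mxE mul0n addr0 add0r.
  by apply/matrixP => x y; rewrite !mxE expr0 rmorph1 mul1r.
rewrite big1 // => i iS; rewrite ffunE ifF ?scaler0 //.
apply: contraFF cS => /eqP Si; rewrite (cardsD1 i S) iS Si cards0 //.
Qed.

Lemma cech_d_empty_cochain_inj r : D (empty_cochain r) = 0 -> r = 0.
Proof.
move/ffunP/(_ [set ord0]); rewrite cech_dE big_set1 !ffunE setDv eqxx.
move/matrixP/(_ ord0 ord0); rewrite !mxE.
move/(congr1 (fun x => sgn K ord0 [set ord0] * x)).
by rewrite mulrA sgn_sq mul1r mulr0 => /eqP; rewrite tofrac_eq0 => /eqP.
Qed.

(** Cocycles are the restrictions of global sections, that is, of polynomials
    of degree t. *)
Lemma cohom_degree0 :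
  qdim const_frac (cocycles D (cochain a0 full t) (cochain a0 zero t) 0)
    (coboundaries D (cochain a0 full t) (cochain a0 zero t) 0) (size (monomials t)).
Proof.
have dD := cech_differential 1.
have cF := cochain_subcomplex a0 t full_submodule.
have cZ := cochain_subcomplex a0 t (@zero_submodule 1).
set s := monomials t; have us : uniq s := uniq_monomials t.
have -> : size s = #|'I_(size s)| by rewrite card_ord.
apply: (qbasis_qdim (e := fun j : 'I_(size s) => D (empty_cochain 'X_[nth 0%MM s j]))).
  exact: coboundaries_subspace.
split=> [j|c [Cc /cochain_zero Dc]|c /cochain_zero].
- apply: cocycle_empty_cochain; apply/homogzP => m; rewrite mcoeffX.
  case: (_ =P m) => [<- _|_]; last by rewrite eqxx.
  by apply/eqP; rewrite -mem_monomials mem_nth.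
- have [N [w [h [_ [hl h0] wl w0 cE]]]] := cocycle_decomposition 0 Cc Dc.
  have [q [hq tq]] := laurent_divide (hl set0 (cards0 _)).
  rewrite cards0 muln0 add0r setC0 in hq tq.
  have hE : laurent_cochain N h = empty_cochain q.
    apply/ffunP => S; rewrite !ffunE; case: eqP => [->|/eqP S0].
      by rewrite hq tofracM mulrCA mulVf ?mulr1 ?tf_x_prod_neq0.
    by rewrite h0 ?cards_eq0 // rmorph0 mulr0; apply/matrixP => x y; rewrite !mxE.
  have pE : laurent_cochain N (fun S => polar_part N (w S)) = 0.
    apply/ffunP => S; rewrite !ffunE.
    have -> : polar_part N (w S) = 0.
      have [cS|cS] := eqVneq #|S| 1%N; last first.
        by rewrite w0 // /polar_part /mfilter msupp0 big_nil.
      apply: (polar_part0 (t := t) (S := S)); last exact: wl.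
      by apply: contra_eq_neq cS => ->; rewrite cardsT card_ord.
    by rewrite rmorph0 mulr0; apply/matrixP => x y; rewrite !mxE.
  exists (fun j : 'I_(size s) => q@_(nth 0%MM s j)); apply/cochain_zero.
  rewrite -cech_d_sum empty_cochain_sum -poly_indexed //; last first.
    by move=> m qm; rewrite mem_monomials; apply/eqP; move/homogzP: tq; apply.
  by rewrite cE hE pE addr0 subrr.
rewrite -cech_d_sum empty_cochain_sum => /cech_d_empty_cochain_inj h0 j.
by rewrite -(coeff_indexed c j us) h0 mcoeff0.
Qed.

(** Over D(x_S) with S different from 'I_4 there is no polar part. *)
Lemma cohom_middle p : (0 < p < 3)%N ->
  qdim const_frac (cocycles D (cochain a0 full t) (cochain a0 zero t) p)
    (coboundaries D (cochain a0 full t) (cochain a0 zero t) p) 0.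
Proof.
have dD := cech_differential 1.
have cF := cochain_subcomplex a0 t full_submodule.
have cZ := cochain_subcomplex a0 t (@zero_submodule 1).
case: p => // p /andP[_ p3]; apply: qdim0; first exact: coboundaries_subspace.
move=> c [Cc /cochain_zero Dc].
have [N [w [h [_ [hl h0] wl w0 cE]]]] := cocycle_decomposition 0 Cc Dc.
have x0 := tf_x_prod_neq0 setT N.
exists (laurent_cochain N h); split.
  move=> S; rewrite ffunE; case: ifP => [/eqP cS|/negbT cS].
    apply/sections_laurent; exists N, (h S); split; first exact: hl.
    by rewrite mxE mulVKf.
  by rewrite h0 // rmorph0 mulr0; apply/matrixP => x y; rewrite !mxE.
apply/cochain_zero; rewrite {1}cE addrC addKr.
apply/ffunP => S; rewrite !ffunE.
have -> : polar_part N (w S) = 0.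
  have [cS|cS] := eqVneq #|S| p.+2; last first.
    by rewrite w0 // /polar_part /mfilter msupp0 big_nil.
  apply: (polar_part0 (t := t) (S := S)); last exact: wl.
  apply: contra_eq_neq cS => ->; rewrite cardsT card_ord.
  by case: p p3 {Cc Dc hl h0 wl w0 cE} => [|[|]].
by rewrite rmorph0 mulr0; apply/matrixP => x y; rewrite !mxE.
Qed.

Implicit Types (u : 'X_{1..4}).

(** With denominator (x_0 x_1 x_2 x_3)^N, the exponent of the numerator of
    1 / x^(u + 1). *)
Definition flip N (u : 'X_{1..4}) : 'X_{1..4} :=
  (mnm_on N setT - (u + mnm_on 1 setT))%MM.

Definition top_monomial N u S : R := if S == setT then 'X_[flip N u] else 0.

Definition inverse_monomial u : E :=
  [ffun S : {set 'I_4} =>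
     if S == setT then const_mx (tf 'X_[u + mnm_on 1 setT])^-1 else 0].

Lemma tfX_neq0 (u : 'X_{1..4}) : tf ('X_[u] : R) != 0.
Proof. by rewrite tofrac_eq0 -msupp_eq0 msuppX. Qed.

Lemma flip_le N u : (forall i, u i < N)%N ->
  (u + mnm_on 1 setT <= mnm_on N setT)%MM.
Proof. by move=> uN; apply/mnm_lepP => i; rewrite mnmDE !mnmE !inE addn1. Qed.

Lemma inverse_monomialE N u : (forall i, u i < N)%N ->
  inverse_monomial u = laurent_cochain N (top_monomial N u).
Proof.
move=> uN; apply/ffunP => S; rewrite !ffunE /top_monomial; case: ifP => _; last first.
  by rewrite rmorph0 mulr0; apply/matrixP => x y; rewrite !mxE.
congr const_mx; rewrite x_prod_monomial -{1}(submK (flip_le uN)).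
by rewrite [in RHS]mpolyXD tofracM invfM mulrAC mulVf ?mul1r ?tfX_neq0.
Qed.

Lemma eq_laurent_cochain N (h h' : {set 'I_4} -> R) :
  h =1 h' -> laurent_cochain N h = laurent_cochain N h'.
Proof. by move=> hh; apply/ffunP => S; rewrite !ffunE hh. Qed.

Lemma laurent_cochain_sum N (J : finType) (c : J -> k) (h : J -> {set 'I_4} -> R) :
  \sum_j const_frac (c j) *: laurent_cochain N (h j) =
  laurent_cochain N (fun S => \sum_j c j *: h j S).
Proof.
apply/ffunP => S; apply/matrixP => x y; rewrite sum_ffunE !ffunE summxE mxE.
rewrite rmorph_sum mulr_sumr /=; apply: eq_bigr => j _.
by rewrite ffunE mxE ffunE mxE -const_fracM mulrCA.
Qed.

Lemma mdeg_flip N u : (forall i, u i < N)%N ->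
  (mdeg (flip N u) + mdeg u + 4 = N * 4)%N.
Proof.
move=> uN; rewrite -(mdeg_mnm_on_setT N) -[in RHS](submK (flip_le uN)) !mdegD.
by rewrite mdeg_mnm_on_setT addnA.
Qed.

Lemma flipK N u : (forall i, u i < N)%N -> flip N (flip N u) = u.
Proof.
move=> uN; apply/mnmP => i; have := uN i; rewrite !(mnmBE, mnmDE) !mnmE !inE; lia.
Qed.

Lemma flip_lt N u : (0 < N)%N -> forall i, (flip N u i < N)%N.
Proof. by move=> N0 i; rewrite mnmBE mnmDE !mnmE !inE; lia. Qed.

Lemma monomial_bound (m : 'X_{1..4}) i : (m i <= mdeg m)%N.
Proof. by rewrite mdegE (bigD1 i) //= leq_addr. Qed.

(** The Laurent monomials with negative exponents only form a basis: they are
    the 1 / x^(u + 1) with u of degree - 4 - t. *)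
Lemma cohom_degree3 :
  qdim const_frac (cocycles D (cochain a0 full t) (cochain a0 zero t) 3)
    (coboundaries D (cochain a0 full t) (cochain a0 zero t) 3)
    (size (monomials (- 4%:Z - t))).
Proof.
have dD := cech_differential 1.
have cF := cochain_subcomplex a0 t full_submodule.
have cZ := cochain_subcomplex a0 t (@zero_submodule 1).
have Dtop c : cochain a0 full t 3 c -> D c = 0.
  by move=> Cc; apply: (@cochain_top _ a0 full t); case: cF => _; apply.
set s := monomials _; have us : uniq s := uniq_monomials _.
(* With N >= N0 every monomial of degree - 4 - t has all its exponents below
   N, and the subtraction in its flip is not truncated. *)
pose N0 := (absz t).+1.
have sdeg (j : 'I_(size s)) : (mdeg (nth 0%MM s j))%:Z = - 4%:Z - t.
  by apply/eqP; rewrite -mem_monomials mem_nth.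
have sN N (j : 'I_(size s)) : (N0 <= N)%N -> forall i, (nth 0%MM s j i < N)%N.
  by move=> N0N i; have := sdeg j; have := monomial_bound (nth 0%MM s j) i; lia.
pose so N := map (flip N) s.
have size_so N : size (so N) = size s by rewrite size_map.
have uso N : (N0 <= N)%N -> uniq (so N).
  move=> N0N; rewrite map_inj_in_uniq // => u v.
  move=> /(nthP 0%MM)[i si <-] /(nthP 0%MM)[j sj <-].
  move=> e; rewrite -[LHS](@flipK N) ?e ?flipK //.
    exact: (sN N (Ordinal sj)).
  exact: (sN N (Ordinal si)).
have nth_so N (j : 'I_(size s)) : nth 0%MM (so N) j = flip N (nth 0%MM s j).
  by rewrite (nth_map 0%MM).
have sum_so N (c : 'I_(size s) -> k) : (N0 <= N)%N ->
    \sum_j const_frac (c j) *: inverse_monomial (nth 0%MM s j) =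
    laurent_cochain N
      (fun S => if S == setT then \sum_j c j *: 'X_[nth 0%MM (so N) j] else 0).
  move=> N0N; rewrite (eq_bigr (fun j => const_frac (c j) *:
      laurent_cochain N (top_monomial N (nth 0%MM s j)))).
    rewrite laurent_cochain_sum; apply: eq_laurent_cochain => S.
    rewrite /top_monomial; case: ifP => _.
      by apply: eq_bigr => j _; rewrite nth_so.
    by rewrite big1 // => j _; rewrite scaler0.
  by move=> j _; rewrite (inverse_monomialE (sN N j N0N)).
have -> : size s = #|'I_(size s)| by rewrite card_ord.
apply: (qbasis_qdim (e := fun j : 'I_(size s) => inverse_monomial (nth 0%MM s j))).
  exact: coboundaries_subspace.
have card4 S : (#|S| == 4) = (S == setT).
  have := max_card (mem S); rewrite card_ord => S4.
  by rewrite eqEcard subsetT cardsT card_ord eqn_leq S4.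
split=> [j|c [Cc /cochain_zero Dc]|c [b [Cb /cochain_zero bE]]].
- have Cd : cochain a0 full t 3 (inverse_monomial (nth 0%MM s j)).
    move=> S; rewrite (inverse_monomialE (sN N0 j (leqnn _))) ffunE /top_monomial card4.
    case: eqP => [->|_]; last first.
      by rewrite rmorph0 mulr0; apply/matrixP => x y; rewrite !mxE.
    apply/sections_laurent; exists N0, 'X_[flip N0 (nth 0%MM s j)]; split.
      move=> m; rewrite mcoeffX; case: (_ =P m) => [<- _|_]; last by rewrite eqxx.
      split=> [|i]; last by rewrite inE.
      by have := mdeg_flip (sN N0 j (leqnn _)); have := sdeg j; lia.
    by rewrite mxE mulVKf ?tf_x_prod_neq0.
  by split=> //; apply/cochain_zero/Dtop.
- have [N [w [h [N0N [hl h0] wl w0 cE]]]] := cocycle_decomposition N0 Cc Dc.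
  exists (fun j : 'I_(size s) => (polar_part N (w setT))@_(nth 0%MM (so N) j)).
  exists (laurent_cochain N h); split.
    move=> S; rewrite ffunE; case: ifP => [/eqP cS|/negbT cS].
      apply/sections_laurent; exists N, (h S); split; first exact: hl.
      by rewrite mxE mulVKf ?tf_x_prod_neq0.
    by rewrite h0 // rmorph0 mulr0; apply/matrixP => x y; rewrite !mxE.
  apply/cochain_zero; rewrite (sum_so N _ N0N) {1}cE addrAC [D _ + _]addrC addrK.
  apply/eqP; rewrite subr_eq0; apply/eqP; apply: eq_laurent_cochain => S.
  case: eqP => [->|/eqP ST]; last first.
    by rewrite w0 ?card4 // /polar_part /mfilter msupp0 big_nil.
  rewrite -(size_so N); apply: poly_indexed; first exact: uso.
  move=> m; rewrite coeff_mfilter; case: (_ =P None) => [mN wm|_]; last by rewrite eqxx.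
  have {}mN := free_index_none mN.
  apply/mapP; exists (flip N m); last by rewrite flipK.
  have [|dm _] := wl setT _ m wm; first by rewrite cardsT card_ord.
  by rewrite mem_monomials; have := mdeg_flip mN; lia.
have [N [w [N0N wb wl w0]]] := cochain_numerators N0 Cb.
(* The exponents in the sum are all below N, while every term of the
   coboundary comes from a face omitting some i, whose numerators have
   exponent at least N at i. *)
have pE : \sum_j c j *: 'X_[nth 0%MM (so N) j] = poly_d w setT.
  apply/eqP; rewrite -tofrac_eq (cech_d_numerator wb).
  move/eqP: bE; rewrite subr_eq0 => /eqP <-; rewrite (sum_so N _ N0N) ffunE eqxx mxE.
  by rewrite mulVKf ?tf_x_prod_neq0.
move=> j.
have := coeff_indexed (fun i : 'I_(size (so N)) => c (cast_ord (size_so N) i))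
  (cast_ord (esym (size_so N)) j) (uso N N0N).
rewrite cast_ordKV => <-.
have -> : \sum_(i < size (so N)) c (cast_ord (size_so N) i) *: 'X_[nth 0%MM (so N) i]
   = poly_d w setT.
  rewrite -pE [RHS](reindex (cast_ord (size_so N))) //.
  by exists (cast_ord (esym (size_so N))) => i _; rewrite ?cast_ordK ?cast_ordKV.
rewrite /= coeff_poly_d /simplex_d big1 // => i _.
suff -> : (w (setT :\ i))@_(nth 0%MM (so N) j) = 0 by rewrite mulr0.
have ci : #|setT :\ i| = 3%N.
  by have := cardsD1 i setT; rewrite cardsT card_ord inE => -[].
apply/eqP; apply: contraT => /(wl _ ci)[_ /(_ i)].
rewrite !inE eqxx => /(_ isT); rewrite nth_so leqNgt flip_lt //.
exact: leq_trans N0N.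
Qed.

(** One of the two terms is always zero; their difference is a polynomial
    function of t. *)
Definition hilbert : int := (size (monomials t))%:Z - (size (monomials (- 4%:Z - t)))%:Z.

Lemma euler_structure : euler_char a0 full zero t hilbert.
Proof.
apply/euler_charE; apply: chi_intro cohom_degree0 _ _ cohom_degree3 _.
- exact: cohom_middle.
- exact: cohom_middle.
- by rewrite /hilbert; lia.
Qed.

End DegreeZero.

Lemma bin3 d : (6 * 'C(d + 3, 3) = (d + 1) * (d + 2) * (d + 3))%N.
Proof.
have := bin_ffact (d + 3) 3; rewrite !ffactnS ffactn0 !factS fact0; lia.
Qed.

Lemma hilbertE t : 6%:Z * hilbert t = (t + 1) * (t + 2%:Z) * (t + 3%:Z).
Proof.
rewrite /hilbert; case: t => [d|[|[|[|d]]]] //.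
  have -> : monomials (- 4%:Z - d%:Z) = [::].
    by rewrite (_ : _ - _ = Negz (d + 3)) //; lia.
  by have := bin3 d; rewrite size_monomials /=; lia.
have -> : - 4%:Z - Negz d.+3 = d%:Z by lia.
by have := bin3 d; rewrite size_monomials /=; lia.
Qed.

End StructureSheaf.

(** * The exact sequences attached to a pair of forms *)

Local Notation full n := (fun _ : 'cV[R]_n => True).
Local Notation zero n := (fun w : 'cV[R]_n => w = 0).

Lemma euler_eq_modules n (a : 'I_n -> int) (A A' B B' : 'cV[R]_n -> Prop) t z :
  (forall w, A w <-> A' w) -> (forall w, B w <-> B' w) ->
  euler_char a A B t z -> euler_char a A' B' t z.
Proof.
move=> AA BB; have [h _] : euler_char a A B t z <-> euler_char a A' B' t z.
  apply: euler_ext => S v _; split; apply: sections_mono => w;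
  by [move/AA | move/BB].
exact: h.
Qed.

Lemma euler_same_subsheaf n (a : 'I_n -> int) (A A' B B' : 'cV[R]_n -> Prop) t z :
  submodule A -> submodule A' -> submodule B -> submodule B' ->
  same_subsheaf a A A' -> same_subsheaf a B B' ->
  euler_char a A B t z -> euler_char a A' B' t z.
Proof.
move=> sA sA' sB sB' AA BB.
have same_sym C C' : same_subsheaf a C C' -> same_subsheaf a C' C.
  by move=> CC i v; apply: iff_sym; apply: CC.
have [h _] : euler_char a A B t z <-> euler_char a A' B' t z.
  apply: euler_ext => S v S0; split; apply: same_subsheaf_sections => //;
  exact: same_sym.
exact: h.
Qed.

Lemma euler_twist n (a a' : 'I_n -> int) (s : int) (A B : 'cV[R]_n -> Prop) t z :
  (forall j, a' j = a j + s) ->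
  euler_char a' A B t z <-> euler_char a A B (s + t) z.
Proof.
move=> aE.
have E C S v : sections a' C t S v <-> sections a C (s + t) S v.
  have gE y w : graded_piece a' (y + t) w <-> graded_piece a (y + (s + t)) w.
    split=> h j; have := h j; rewrite aE.
      by rewrite (_ : y + t + (a j + s) = y + (s + t) + a j) //; ring.
    by rewrite (_ : y + t + (a j + s) = y + (s + t) + a j) //; ring.
  by split=> -[N [w [Cw /gE gw ew]]]; exists N, w.
by apply: euler_ext => S v _; apply: E.
Qed.

Lemma euler_line_bundle (s t : int) :
  euler_char (fun _ : 'I_1 => s) (full 1) (zero 1) t (hilbert (s + t)).
Proof.
apply/(euler_twist (a := fun _ => 0) (s := s)); first by move=> j; rewrite add0r.
exact: euler_structure.
Qed.

Lemma euler_trivial n (a : 'I_n -> int) (A : 'cV[R]_n -> Prop) t :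
  submodule A -> euler_char a A A t 0.
Proof.
move=> sA; apply/euler_charE; have cA := cochain_subcomplex a t sA.
have dD := cech_differential n.
have H p : qdim const_frac (cocycles (@cech_d k n) (cochain a A t) (cochain a A t) p)
    (coboundaries (@cech_d k n) (cochain a A t) (cochain a A t) p) 0.
  apply: qdim0; first exact: coboundaries_subspace.
  by move=> c [Cc _]; apply: (sub_coboundaries dD cA).
by apply: (chi_intro (H 0%N) (H 1%N) (H 2%N) (H 3%N)); rewrite !subr0.
Qed.

(** Induction along the filtration by the submodules of vectors whose
    coordinates vanish from i on; the quotients are line bundles. *)
Lemma euler_free n (a : 'I_n -> int) (t : int) :
  euler_char a (full n) (zero n) t (\sum_j hilbert (a j + t)).
Proof.
pose F i (w : 'cV[R]_n) := forall j : 'I_n, (i <= j)%N -> w j ord0 = 0.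
have sF i : submodule (F i).
  split=> [j _|r u v Fu Fv j ij]; first by rewrite mxE.
  by rewrite !mxE Fu // Fv // mulr0 addr0.
suff H i : (i <= n)%N ->
    euler_char a (F i) (zero n) t (\sum_(j : 'I_n | (j < i)%N) hilbert (a j + t)).
  have := H n (leqnn n); rewrite (eq_bigl xpredT) => [|j]; last by rewrite ltn_ord.
  apply: euler_eq_modules => // w; split=> // _ j.
  by rewrite leqNgt ltn_ord.
elim: i => [_|i IHi lt_in].
  rewrite big_pred0 //.
  apply: (euler_eq_modules (A := zero n) (B := zero n)) => //.
    move=> w; split=> [-> j _|Fw]; first by rewrite mxE.
    by apply/matrixP => j x; rewrite ord1 mxE Fw.
  exact/euler_trivial/zero_submodule.
(* The quotient of F i.+1 by F i is the line bundle of coordinate i. *)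
pose j0 := Ordinal lt_in; pose phi (w : 'cV[R]_n) : 'cV[R]_1 := const_mx (w j0 ord0).
have Fi_kernel w : hom_kernel (F i.+1) phi w <-> F i w.
  split=> [[Fw /matrixP/(_ ord0 ord0)]|Fw].
    rewrite !mxE => wj j; rewrite leq_eqVlt => /orP[/eqP ij|/Fw //].
    by rewrite -wj; congr (w _ _); apply: val_inj.
  split=> [j ij|]; first by apply: Fw; apply: ltnW.
  by apply/matrixP => x y; rewrite !mxE Fw.
have Fi_image w : hom_image (F i.+1) phi w <-> full 1 w.
  split=> // _; exists (\col_j (if j == j0 then w ord0 ord0 else 0)); split.
    by move=> j ij; rewrite mxE; case: eqP ij => // ->; rewrite ltnn.
  by apply/matrixP => x y; rewrite !ord1 !mxE eqxx.
rewrite (bigID (fun j : 'I_n => (j < i)%N)) /=.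
rewrite (eq_bigl (fun j : 'I_n => (j < i)%N)); last first.
  by move=> j; case: (ltnP j i) => ji; rewrite ?andbF // andbT ltnS ltnW.
rewrite [X in _ + X](big_pred1 j0); last first.
  by move=> j; rewrite -leqNgt ltnS -eqn_leq.
apply: (euler_add (A1 := F i)) => //.
- exact: (@zero_submodule n).
- by move=> w -> j _; rewrite mxE.
- by move=> w Fw j ij; apply: Fw; apply: ltnW.
- by apply: IHi; apply: ltnW.
apply: (euler_eq_modules (A := F i.+1) (B := hom_kernel (F i.+1) phi)) => //.
apply/(euler_morphism (a2 := fun _ => a j0)) => //.
- by move=> z v Fv j ij; rewrite mxE Fv //; case: (z + a j) => //= d; rewrite raddf0.
- by move=> r u v _ _; apply/matrixP => x y; rewrite !mxE.
- by move=> z v _ gv j; rewrite mxE; apply: gv.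
apply: (euler_eq_modules (A := full 1) (B := zero 1)) => //.
- by move=> w; apply: iff_sym.
exact: euler_line_bundle.
Qed.

Lemma mderiv_homog (p : R) d i : p \is d.+1.-homog -> p^`M(i) \is d.-homog.
Proof.
move=> hp; apply/dhomogP => m; rewrite mcoeff_msupp mcoeff_deriv => nz.
have /(dhomog_mf hp) : (m + U_(i))%MM \in msupp p.
  by rewrite mcoeff_msupp; apply: contraNneq nz => ->; rewrite mul0rn.
by rewrite /= mdegD mdeg1 addn1 => -[].
Qed.

Section Curve.

Variables (f g : R) (df dg : nat).
Hypotheses (hf : f \is df.+1.-homog) (hg : g \is dg.+1.-homog).

Let J (v : 'cV[R]_4) : 'cV[R]_2 := jacobian f g *m v.
Local Notation tw := (jac_twist df dg).
Local Notation tangent := (tangent_sheaf f g).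

Lemma jacobian_graded z v : graded_piece (fun _ => 0) z v ->
  graded_piece tw z (J v).
Proof.
move=> gv i; rewrite mxE; apply: homogz_sum => j.
rewrite addrC; apply: homogzM; last by have := gv j; rewrite addr0.
rewrite mxE; case: i => -[|[|//]] lt_i2; exact: mderiv_homog.
Qed.

Lemma jacobian_linear r u v : J (r *: u + v) = r *: J u + J v.
Proof. by rewrite /J mulmxDr -scalemxAr. Qed.

Lemma tangent_submodule : submodule tangent.
Proof.
split=> [|r u v Tu Tv]; first exact: mulmx0.
by rewrite /tangent_sheaf -[_ *m _]/(J _) jacobian_linear /J Tu Tv scaler0 addr0.
Qed.

Lemma tangent_gproj z v : tangent v -> tangent (gproj (fun _ => 0) z v).
Proof.
move=> Tv; suff [] : hom_kernel (full 4) J (gproj (fun _ => 0) z v) by [].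
apply: (hom_kernel_gproj (a2 := tw)) => //.
- by move=> r u w _ _; apply: jacobian_linear.
- by move=> y w _; apply: jacobian_graded.
Qed.

Lemma jacobian_image_submodule : submodule (jacobian_image f g).
Proof.
split=> [|r _ _ [u ->] [v ->]]; first by exists 0; rewrite mulmx0.
by exists (r *: u + v); rewrite mulmxDr -scalemxAr.
Qed.

(** From 0 -> W -> O(df) + O(dg) -> Q -> 0 and 0 -> T -> O^4 -> W -> 0, where W
    is the image of the Jacobian map. *)
Lemma euler_tangent t q :
  euler_char tw (full 2) (jacobian_image f g) t q ->
  euler_char (fun _ => 0) tangent (zero 4) t
    (4%:Z * hilbert t - (hilbert (df%:Z + t) + hilbert (dg%:Z + t) - q)).
Proof.
move=> chiQ.
have chi2 : euler_char tw (full 2) (zero 2) t (hilbert (df%:Z + t) + hilbert (dg%:Z + t)).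
  by have := euler_free tw t; rewrite !big_ord_recl big_ord0 addr0.
have chi4 : euler_char (fun _ : 'I_4 => 0) (full 4) (zero 4) t (4%:Z * hilbert t).
  have := euler_free (fun _ : 'I_4 => 0) t; rewrite sumr_const card_ord add0r.
  by rewrite -mulr_natl natz.
have chiJ : euler_char tw (jacobian_image f g) (zero 2) t
    (hilbert (df%:Z + t) + hilbert (dg%:Z + t) - q).
  apply: (euler_sub (A2 := full 2)) chi2 chiQ => //.
  - exact: (@zero_submodule 2).
  - exact: jacobian_image_submodule.
  - by move=> w ->; exists 0; rewrite mulmx0.
apply: (euler_sub (A2 := full 4)) chi4 _ => //.
- exact: (@zero_submodule 4).
- exact: tangent_submodule.
- by move=> w ->; case: tangent_submodule.
apply: (euler_eq_modules (A := full 4) (B := hom_kernel (full 4) J)) => //.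
  by move=> w; split=> [[]|].
apply/(euler_morphism (a2 := tw)) => //.
- by move=> r u v _ _; apply: jacobian_linear.
- by move=> z v _; apply: jacobian_graded.
apply: euler_eq_modules chiJ => // w.
by split=> [[v ->]|[v [_ ->]]]; exists v.
Qed.

Section Syzygy.

Variables (l : nat) (nu : 'cV[R]_4).
Hypotheses (nu_syz : syzygy f g l nu) (nu0 : nu <> 0).

Lemma line_submodule : submodule (line nu).
Proof.
split=> [|r _ _ [u ->] [v ->]]; first by exists 0; rewrite scale0r.
by exists (r * u + v); rewrite scalerDl scalerA.
Qed.

(** Multiplication by nu is injective: the line is a copy of O(-l). *)
Lemma euler_line t : euler_char (fun _ => 0) (line nu) (zero 4) t (hilbert (- l%:Z + t)).
Proof.
pose phi (r : 'cV[R]_1) : 'cV[R]_4 := r ord0 ord0 *: nu.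
apply: (euler_eq_modules (A := hom_image (full 1) phi) (B := zero 4)) => //.
  move=> w; split=> [[r [_ ->]]|[r ->]]; first by exists (r ord0 ord0).
  by exists (const_mx r); rewrite /phi mxE.
apply/(euler_morphism (a1 := fun _ => - l%:Z)) => //.
- by move=> r u v _ _; rewrite /phi !mxE scalerDl scalerA.
- move=> z v _ gv j; rewrite mxE mulrC addr0.
  rewrite (_ : z = l%:Z + (z - l%:Z)); last by rewrite addrCA subrr addr0.
  by apply: homogzM; [case: nu_syz | apply: gv].
apply: (euler_eq_modules (A := full 1) (B := zero 1)) => //;
  last exact: euler_line_bundle.
move=> w; split=> [->|[_ /eqP]].
  by split=> //; rewrite /phi mxE scale0r.
rewrite scalemx_eq0 => /orP[/eqP w0|/eqP //].
by apply/matrixP => x y; rewrite !ord1 w0 mxE.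
Qed.

Variables (I : R -> Prop).
Hypothesis curveI : associated_curve f g df dg l nu I.

Local Notation s := (l%:Z - (df + dg)%N%:Z).

Lemma ideal_col_submodule : submodule (ideal_col I).
Proof.
case: curveI => -[[I0 ID IM _] _] _; split; first by rewrite /ideal_col mxE.
by move=> r u v Iu Iv; rewrite /ideal_col !mxE; apply: ID => //; apply: IM.
Qed.

(** From 0 -> O(-l) -> T -> I(s) -> 0 and 0 -> I -> O -> O_B -> 0. *)
Lemma euler_curve t q : euler_char tw (full 2) (jacobian_image f g) t q ->
  euler_char (fun _ => 0) (full 1) (ideal_col I) (s + t)
    (hilbert (s + t)
     - (4%:Z * hilbert t - (hilbert (df%:Z + t) + hilbert (dg%:Z + t) - q)
        - hilbert (- l%:Z + t))).
Proof.
move=> chiQ; have [_ [phi [phi_lin phiI phi_gr kerE imE]]] := curveI.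
pose psi (v : 'cV[R]_4) : 'cV[R]_1 := (phi v)%:M.
have psi_lin r u v : tangent u -> tangent v -> psi (r *: u + v) = r *: psi u + psi v.
  by move=> Tu Tv; rewrite /psi phi_lin // raddfD /= scale_scalar_mx.
have sT := tangent_submodule; have sI := ideal_col_submodule.
have sK : submodule (hom_kernel tangent psi) by apply: hom_kernel_submodule.
have sM : submodule (hom_image tangent psi) by apply: hom_image_submodule.
apply: (euler_quot (A0 := zero 1)) => //.
- exact: (@zero_submodule 1).
- by move=> w ->; case: sI.
- apply/(euler_twist (a' := fun _ => s) (s := s)); first by move=> j; rewrite add0r.
  apply: (euler_same_subsheaf (A := hom_image tangent psi) (B := zero 1)) => //.
  + exact: (@zero_submodule 1).
  + exact: (@zero_submodule 1).
  apply/(euler_morphism (a1 := fun _ => 0)) => //.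
  + exact: tangent_gproj.
  + move=> z v Tv gv j; rewrite !ord1 mxE eqxx mulr1n; exact: phi_gr.
  apply: (euler_same_subsheaf (A := tangent) (B := line nu)) => //.
  + exact: line_submodule.
  + move=> i v; apply: iff_sym; apply: iff_trans (kerE i v).
    have psi0 w : psi w = 0 <-> phi w = 0.
      split=> [/matrixP/(_ ord0 ord0)|]; first by rewrite !mxE eqxx mulr1n.
      by rewrite /psi => ->; apply: raddf0.
    by split; apply: sections_mono => w [Tw /psi0 pw].
  apply: (euler_quot (A0 := zero 4)) (euler_line t) (euler_tangent chiQ) => //.
  + exact: (@zero_submodule 4).
  + exact: line_submodule.
  + by move=> w ->; case: line_submodule.
  + by move=> _ [r ->]; apply: submodZ => //; case: nu_syz.
exact: euler_structure.
Qed.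

End Syzygy.

End Curve.

End ProjectiveSpace.

Theorem proposition4 (k : closedFieldType) (char0 : [pchar k] =i pred0)
    (f g : {mpoly k[4]}) (df dg : nat) (normal : normal_sequence f g df dg)
    (m : int) (m_sigma : is_m f g df dg m)
    (l : nat) (nu : 'cV[{mpoly k[4]}]_4) (nu_sat : saturated_syzygy f g l nu)
    (B : {mpoly k[4]} -> Prop) (B_nu : associated_curve f g df dg l nu B) :
  curve_degree B
    (l%:Z ^+ 2 - l%:Z * (df%:Z + dg%:Z)
     + (df%:Z ^+ 2 + dg%:Z ^+ 2 + df%:Z * dg%:Z) - m).
Proof.
have [[hf hg _] _] := normal; have [c chiQ] := m_sigma.
have [nu_syz nu0 _] := nu_sat.
set s := l%:Z - (df + dg)%N%:Z.
(* The Euler characteristic of the structure sheaf of B twisted by t. *)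
pose q t := hilbert t - (4%:Z * hilbert (t - s)
  - (hilbert (df%:Z + (t - s)) + hilbert (dg%:Z + (t - s)) - (m * (t - s) + c))
  - hilbert (- l%:Z + (t - s))).
exists (q 0) => t.
have := euler_curve hf hg nu_syz nu0 B_nu (chiQ (t - s)); rewrite -/s.
rewrite (addrC s) subrK -/(q t).
suff -> : q t = (l%:Z ^+ 2 - l%:Z * (df%:Z + dg%:Z)
    + (df%:Z ^+ 2 + dg%:Z ^+ 2 + df%:Z * dg%:Z) - m) * t + q 0 by [].
(* Six times the Hilbert polynomial: multiplying by 6 clears denominators. *)
pose H (x : int) := (x + 1) * (x + 2%:Z) * (x + 3%:Z).
have q6 x : 6%:Z * q x = H x - (4%:Z * H (x - s)
  - (H (df%:Z + (x - s)) + H (dg%:Z + (x - s)) - 6%:Z * (m * (x - s) + c))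
  - H (- l%:Z + (x - s))).
  by rewrite /q /H -!hilbertE; ring.
apply: (mulfI (x := 6%:Z)) => //.
rewrite [RHS]mulrDr !q6 /H /s PoszD; ring.
Qed.
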